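(* Let $G$ be a finitely generated group with the Morse local-to-global property, and suppose that every stable subgroup of $G$ is separable in $G$. Then for every $n \geq 1$ and all stable subgroups $H_1, \dots, H_n$ of $G$, the setwise product $H_1 \cdots H_n = \{h_1 \cdots h_n : h_i \in H_i\}$ is separable in $G$.
   Context: Profinite topology: the topology on a group $G$ whose basic open sets are the cosets of finite index subgroups of $G$. A subset of $G$ is separable if it is closed in this topology. Cayley graph: for a finite generating set $S$ of $G$, $\mathrm{Cay}(G,S)$ has vertex set $G$, with $g,h$ joined by an edge if $g^{-1}h \in S$ or $h^{-1}g \in S$. It is regarded as a geodesic metric space by giving each edge length one. Quasigeodesics: a map $f\colon X \to Y$ of metric spaces is a $(\lambda,c)$-quasi-isometric embedding ($\lambda \geq 1$, $c \geq 0$) if $\frac{1}{\lambda} d_Y(f(x),f(y)) - c \leq d_X(x,y) \leq \lambda d_Y(f(x),f(y)) + c$ for all $x,y \in X$. A $(\lambda,c)$-quasigeodesic is a $(\lambda,c)$-quasi-isometric embedding of an interval $I \subseteq \mathbb{R}$. Morse quasigeodesics: a Morse gauge is a non-decreasing function $M\colon \mathbb{R}_{\geq 1} \times \mathbb{R}_{\geq 0} \to \mathbb{R}_{\geq 0}$. A quasigeodesic $\gamma\colon I \to X$ is $M$-Morse if for all $\lambda \ge 1$, $c \ge 0$ and any $(\lambda,c)$-quasigeodesic segment $\eta\colon [a,b] \to X$ with $\eta(a) = \gamma(t_1)$, $\eta(b) = \gamma(t_2)$, the Hausdorff distance between $\gamma|_{[t_1,t_2]}$ and $\eta$ is at most $M(\lambda,c)$.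 An $(M;\lambda,c)$-Morse quasigeodesic is a $(\lambda,c)$-quasigeodesic that is $M$-Morse. A path $\gamma \colon I \to X$ is an $(L;M;\lambda,c)$-local Morse quasigeodesic if each subpath $\gamma|_{[t_1,t_2]}$ with $t_2 - t_1 \leq L$ is an $(M;\lambda,c)$-Morse quasigeodesic. Morse local-to-global (MLTG) property: a metric space $X$ has it if for every Morse gauge $M$ and constants $\lambda \geq 1$, $c \geq 0$ there exist $L > 0$, a Morse gauge $M'$ and constants $\lambda' \geq 1$, $c' \geq 0$ such that every $(L;M;\lambda,c)$-local Morse quasigeodesic in $X$ is an $(M';\lambda',c')$-Morse quasigeodesic. A finitely generated group has the MLTG property if its Cayley graph with respect to a finite generating set does. Stable subgroups: let $S$ be a finite generating set of $G$, $M$ a Morse gauge and $\mu \geq 0$. A subgroup $H \leqslant G$ is $(M,\mu)$-stable if any geodesic in $\mathrm{Cay}(G,S)$ with endpoints in $H$ is $M$-Morse and lies in the $\mu$-neighbourhood of $H$. $H$ is stable if it is $(M,\mu)$-stable for some $M$ and $\mu$; this does not depend on the choice of $S$. *)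

(* Defs.v *)
From HB Require Import structures.
From mathcomp Require Import all_boot all_order all_algebra.
From mathcomp Require Import all_classical all_reals all_analysis.

Set Implicit Arguments.
Unset Strict Implicit.
Unset Printing Implicit Defensive.

Import Order.TTheory GRing.Theory Num.Theory.

Local Open Scope classical_set_scope.
Local Open Scope ring_scope.

Section Groups.
Context {G : groupType}.
Implicit Types (H K S : set G).

Definition is_subgroup H : Prop :=
  [/\ H 1%g, forall x y, H x -> H y -> H (x * y)%g & forall x, H x -> H x^-1%g].

Definition lcoset_of (x : G) H : set G := [set (x * k)%g | k in H].

Definition finite_index H : Prop := finite_set [set lcoset_of x H | x in setT].

Lemma is_subgroupI H K : is_subgroup H -> is_subgroup K -> is_subgroup (H `&` K).
Proof.
move=> [H1 HM HV] [K1 KM KV]; split => //.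
- by move=> x y [? ?] [? ?]; split; [exact: HM|exact: KM].
- by move=> x [? ?]; split; [exact: HV|exact: KV].
Qed.

Lemma lcoset_ofI x H K :
  lcoset_of x (H `&` K) = lcoset_of x H `&` lcoset_of x K.
Proof.
apply/seteqP; split=> [_ [k [Hk Kk] <-]|_ [[h Hh <-] [k Kk /mulgI kh]]].
  by split; exists k.
by exists h => //; split => //; rewrite -kh.
Qed.

Lemma finite_indexI H K : finite_index H -> finite_index K ->
  finite_index (H `&` K).
Proof.
move=> fH fK; apply: sub_finite_set (finite_image2 (@setI G) fH fK).
move=> _ [x _ <-]; rewrite lcoset_ofI.
by exists (lcoset_of x H); [exists x|exists (lcoset_of x K); [exists x|]].
Qed.

Lemma lcoset_of_refl x H : is_subgroup H -> lcoset_of x H x.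
Proof. by case=> H1 _ _; exists 1%g => //; rewrite mulg1. Qed.

Lemma lcoset_of_eq x y H : is_subgroup H -> lcoset_of x H y ->
  lcoset_of x H = lcoset_of y H.
Proof.
move=> [H1 HM HV] [h Hh <-]; apply/seteqP; split=> [_ [k Hk <-]|_ [k Hk <-]].
  by exists (h^-1 * k)%g; [apply: HM => //; exact: HV|rewrite -mulgA mulVKg].
by exists (h * k)%g; [exact: HM|rewrite mulgA].
Qed.

(* Left cosets suffice: a right coset of [K] is a left coset of a conjugate of
   [K], which has the same index. *)
Definition finite_index_cosets : set (set G) :=
  [set A | exists x K, [/\ is_subgroup K, finite_index K & A = lcoset_of x K]].

Lemma finite_index_cosets_cover : \bigcup_(A in finite_index_cosets) A = setT.
Proof.
apply/seteqP; split=> // x _.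
have sT : is_subgroup (setT : set G) by [].
exists (lcoset_of x setT); last exact: lcoset_of_refl.
exists x, setT; split => //.
apply: (@sub_finite_set _ _ [set setT]) => //.
move=> _ [y _ <-]; apply/seteqP; split => // z _.
by exists (y^-1 * z)%g => //; rewrite mulVKg.
Qed.

Lemma finite_index_cosets_join (A B : set G) t :
  finite_index_cosets A -> finite_index_cosets B -> A t -> B t ->
  exists C, [/\ finite_index_cosets C, C t & C `<=` A `&` B].
Proof.
move=> [x [H [sH fH ->]]] [y [K [sK fK ->]]].
move=> /(lcoset_of_eq sH) -> /(lcoset_of_eq sK) ->.
exists (lcoset_of t (H `&` K)); split.
- by exists t, (H `&` K); split => //;
    [exact: is_subgroupI|exact: finite_indexI].
- by apply: lcoset_of_refl; exact: is_subgroupI.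
- by rewrite lcoset_ofI.
Qed.

Definition setwise_prod (n : nat) (H : 'I_n -> set G) : set G :=
  [set (\prod_(i < n) h i)%g | h in [set h : 'I_n -> G | forall i, H i (h i)]].

End Groups.

Definition profinite (G : Type) : Type := G.

Section Profinite.
Variable G : groupType.
HB.instance Definition _ := Choice.on (profinite G).
HB.instance Definition _ := isBaseTopological.Build (profinite G)
  (@finite_index_cosets_cover G) (@finite_index_cosets_join G).
End Profinite.

Definition separable (G : groupType) (A : set G) : Prop :=
  closed (A : set (profinite G)).

Record generating_set (G : groupType) := GeneratingSet {
  gens :> set G ;
  gens_finite : finite_set gens ;
  gens_generate : smallest is_subgroup gens = setT }.

Definition finitely_generated (G : groupType) : Prop :=
  inhabited (generating_set G).

(* Geometric realization of the Cayley graph: a point is given by its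
   barycentric coordinates, i.e. the point at distance t from g on the edge
   {g, h} is the function (1 - t) 1_g + t 1_h.  The graph is simplicial: if 1
   belongs to S, the loops are ignored. *)
Section Cayley.
Context {R : realType} {G : groupType}.

Definition segment_point (g h : G) (t : R) : G -> R :=
  fun x => (1 - t) * (x == g)%:R + t * (x == h)%:R.

Definition closed_segment (g h : G) : set (G -> R) :=
  [set segment_point g h t | t in `[0, 1]].

Variable S : generating_set G.

Definition adjacent (g h : G) : Prop :=
  gens S (g^-1 * h)%g \/ gens S (h^-1 * g)%g.

(* [g = h] yields the vertex [g] alone. *)
Definition simplex (g h : G) : Prop := g = h \/ adjacent g h.

Definition cayley : Type :=
  {p : G -> R | exists g h, simplex g h /\ closed_segment g h p}.

Definition cay_coord (p : cayley) : G -> R := proj1_sig p.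
Coercion cay_coord : cayley >-> Funclass.

Lemma vertex_subproof (g : G) :
  exists h k, simplex h k /\ closed_segment h k (segment_point g g 0).
Proof.
exists g, g; split; first by left.
by exists 0 => //=; rewrite in_itv /= lexx ler01.
Qed.

Definition vertex (g : G) : cayley := exist _ _ (vertex_subproof g).

(* [polyline p q l]: there is a path of length l from p to q which is a
   concatenation of finitely many segments, each contained in one closed edge;
   the first coordinate parametrizes {g, h} by arc length. *)
Inductive polyline : cayley -> cayley -> R -> Prop :=
| polyline_nil (p : cayley) : polyline p p 0
| polyline_cons (p q r : cayley) (g h : G) (l : R) :
    simplex g h -> closed_segment g h p -> closed_segment g h q ->
    polyline q r l -> polyline p r (`|p g - q g| + l).

Definition cay_dist (p q : cayley) : R := inf [set l | polyline p q l].

Lemma cayley_ext (p q : cayley) : (p : G -> R) = q -> p = q.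
Proof. by case: p q => [p pP] [q qP]; rewrite /cay_coord /= => pq; subst q; congr exist; exact: Prop_irrelevance. Qed.

Lemma polyline_ge0 p q l : polyline p q l -> 0 <= l.
Proof. by elim=> // *; rewrite addr_ge0. Qed.

Lemma polyline_cat p q r l m :
  polyline p q l -> polyline q r m -> polyline p r (l + m).
Proof.
elim=> {p q l} [p|p q q' g h l gh gp gq _ IH] qr; first by rewrite add0r.
by rewrite -addrA; apply: (polyline_cons gh gp gq); exact: IH.
Qed.

Lemma polyline_sym p q l : polyline p q l -> polyline q p l.
Proof.
elim=> {p q l} [p|p q r g h l gh gp gq _ IH]; first exact: polyline_nil.
rewrite addrC; apply: (polyline_cat IH).
rewrite -[X in polyline _ _ X]addr0 distrC.
by apply: (polyline_cons gh gq gp); exact: polyline_nil.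
Qed.

Lemma closed_segment_coord (g h : G) (p q : G -> R) (x : G) :
  closed_segment g h p -> closed_segment g h q ->
  `|p x - q x| <= `|p g - q g|.
Proof.
move=> [s _ <-] [t _ <-]; rewrite /segment_point eqxx.
have [->|xg] := eqVneq x g; first by rewrite ?eqxx.
have [gh|gh] := eqVneq g h.
  by rewrite -gh (negPf xg) !mulr0 addr0 subrr normr0.
have [_|_] := eqVneq x h.
  rewrite !(mulr0, mulr1, addr0, add0r) opprB.
  by rewrite [in leRHS]addrC addrA subrK distrC.
by rewrite !(mulr0, addr0) subrr normr0 normr_ge0.
Qed.

Lemma polyline_coord (p q : cayley) l : polyline p q l -> forall x, `|p x - q x| <= l.
Proof.
elim=> {p q l} [p|p q r g h l gh gp gq _ IH] x; first by rewrite subrr normr0.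
rewrite (le_trans (ler_distD (q x) _ _))// lerD//.
exact: closed_segment_coord gp gq.
Qed.

Lemma closed_segmentl (g h : G) : closed_segment g h (vertex g).
Proof.
exists 0; first by rewrite /= in_itv /= lexx ler01.
by apply/funext=> x; rewrite /= /segment_point !mul0r.
Qed.

Lemma closed_segmentr (g h : G) : closed_segment g h (vertex h).
Proof.
exists 1; first by rewrite /= in_itv /= lexx ler01.
by apply/funext=> x; rewrite /= /segment_point subrr !mul0r !mul1r addrC subr0 mul1r.
Qed.

Lemma polyline_edge (p q : cayley) g h : simplex g h ->
  closed_segment g h p -> closed_segment g h q -> exists l, polyline p q l.
Proof.
by move=> gh gp gq; eexists; apply: (polyline_cons gh gp gq (polyline_nil q)).
Qed.

Lemma polyline_connected (p q : cayley) : exists l, polyline p q l.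
Proof.
pose A := [set k : G | forall g, exists l, polyline (vertex g) (vertex (g * k)%g) l].
have sA : is_subgroup A.
  split=> [g|x y Ax Ay g|x Ax g].
  - by exists 0; rewrite mulg1; exact: polyline_nil.
  - have [l gl] := Ax g; have [m gm] := Ay (g * x)%g.
    by exists (l + m); rewrite mulgA; exact: polyline_cat gl gm.
  - have [l] := Ax (g * x^-1)%g; rewrite mulgVK => /polyline_sym.
    by exists l.
have SA : S `<=` A.
  move=> s Ss g; apply: (@polyline_edge _ _ g (g * s)%g).
  - by right; left; rewrite mulKg.
  - exact: closed_segmentl.
  - exact: closed_segmentr.
have AT k : A k.
  have : smallest is_subgroup S k by rewrite gens_generate.
  by apply.
have toV (r : cayley) : exists g l, polyline r (vertex g) l.
  case: (proj2_sig r) => g [h [gh gr]]; exists g.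
  exact: (polyline_edge gh gr (closed_segmentl g h)).
have [g [l pg]] := toV p; have [h [m qh]] := toV q.
have [k] := AT (g^-1 * h)%g g; rewrite mulVKg => gh.
exists (l + (k + m)); apply: (polyline_cat pg); apply: (polyline_cat gh).
exact: polyline_sym.
Qed.

Lemma polyline_has_inf p q : has_inf [set l | polyline p q l].
Proof.
split; first exact: polyline_connected.
by exists 0 => l; exact: polyline_ge0.
Qed.

Lemma cay_dist_le p q l : polyline p q l -> cay_dist p q <= l.
Proof. by move=> pl; apply: ge_inf => //; case: (polyline_has_inf p q). Qed.

Lemma cay_dist_ge p q m :
  (forall l, polyline p q l -> m <= l) -> m <= cay_dist p q.
Proof.
by move=> H; apply: lb_le_inf => //; case: (polyline_has_inf p q).
Qed.

Lemma cay_distxx p : cay_dist p p = 0.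
Proof.
apply/eqP; rewrite eq_le cay_dist_le/=; last exact: polyline_nil.
by apply: cay_dist_ge => l; exact: polyline_ge0.
Qed.

Lemma cay_dist_positivity p q : cay_dist p q = 0 -> p = q.
Proof.
move=> pq0; apply: cayley_ext; apply/funext=> x.
apply/eqP; rewrite -subr_eq0 -normr_le0 -pq0.
by apply: cay_dist_ge => l /polyline_coord.
Qed.

Lemma cay_dist_sym p q : cay_dist p q = cay_dist q p.
Proof.
by apply/eqP; rewrite eq_le; apply/andP; split;
  apply: cay_dist_ge => l /polyline_sym; exact: cay_dist_le.
Qed.

Lemma cay_dist_triangle q p r : cay_dist p r <= cay_dist p q + cay_dist q r.
Proof.
rewrite -lerBlDr; apply: cay_dist_ge => l pq.
rewrite lerBlDr -lerBlDl; apply: cay_dist_ge => m qr.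
by rewrite lerBlDl; apply: cay_dist_le; exact: polyline_cat pq qr.
Qed.

HB.instance Definition _ := gen_eqMixin cayley.
HB.instance Definition _ := gen_choiceMixin cayley.
HB.instance Definition _ := @isMetric.Build R cayley cay_dist
  cay_distxx cay_dist_positivity cay_dist_sym cay_dist_triangle.

End Cayley.
Arguments cayley R {G} S.

Section Morse.
Context {R : realType}.

(* Maps with a domain D are total functions of which only the values on D
   matter. *)
Definition quasi_isometric_embedding (X Y : metricType R) (lambda c : R)
    (D : set X) (f : X -> Y) : Prop :=
  forall x y, D x -> D y ->
    lambda^-1 * mdist (f x) (f y) - c <= mdist x y
    <= lambda * mdist (f x) (f y) + c.

Variable X : metricType R.
Implicit Types (I : set R) (gamma eta : R -> X) (M : R -> R -> R).
Implicit Types (lambda c L mu : R).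

Definition neighbourhood (mu : R) (A : set X) : set X :=
  [set x | exists2 a, A a & mdist x a <= mu].

Definition hausdorff_dist (A B : set X) : \bar R :=
  ereal_inf [set r%:E | r in
    [set r : R | [/\ 0 <= r, A `<=` neighbourhood r B
                   & B `<=` neighbourhood r A]]].

Definition quasigeodesic lambda c I gamma : Prop :=
  is_interval I /\
  quasi_isometric_embedding lambda c (I : set R^o) (gamma : R^o -> X).

Definition geodesic I gamma : Prop :=
  is_interval I /\
  forall s t, I s -> I t -> mdist (gamma s) (gamma t) = `|s - t|.

(* Gauges are total functions; only the values M lambda c with 1 <= lambda and
   0 <= c matter. *)
Definition morse_gauge M : Prop :=
  (forall lambda c, 1 <= lambda -> 0 <= c -> 0 <= M lambda c) /\
  (forall lambda lambda' c c', 1 <= lambda -> 0 <= c ->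
     lambda <= lambda' -> c <= c' -> M lambda c <= M lambda' c').

Definition morse M I gamma : Prop :=
  forall lambda c, 1 <= lambda -> 0 <= c ->
  forall (a b : R) eta, a <= b -> quasigeodesic lambda c `[a, b] eta ->
  forall t1 t2, I t1 -> I t2 -> t1 <= t2 ->
    eta a = gamma t1 -> eta b = gamma t2 ->
    (hausdorff_dist (gamma @` `[t1, t2]) (eta @` `[a, b])
       <= (M lambda c)%:E)%E.

Definition morse_quasigeodesic M lambda c I gamma : Prop :=
  quasigeodesic lambda c I gamma /\ morse M I gamma.

Definition local_morse_quasigeodesic L M lambda c I gamma : Prop :=
  is_interval I /\
  forall t1 t2, I t1 -> I t2 -> t1 <= t2 -> t2 - t1 <= L ->
    morse_quasigeodesic M lambda c `[t1, t2] gamma.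

Definition morse_local_to_global : Prop :=
  forall M lambda c, morse_gauge M -> 1 <= lambda -> 0 <= c ->
  exists L M' lambda' c',
    [/\ 0 < L, morse_gauge M', 1 <= lambda', 0 <= c' &
      forall I gamma, local_morse_quasigeodesic L M lambda c I gamma ->
        morse_quasigeodesic M' lambda' c' I gamma].

End Morse.

Definition MLTG_group (R : realType) (G : groupType) : Prop :=
  exists S : generating_set G, morse_local_to_global (cayley R S).

Definition stable_wrt (R : realType) (G : groupType) (S : generating_set G)
    (M : R -> R -> R) (mu : R) (H : set G) : Prop :=
  forall (a b : R) (gamma : R -> cayley R S), a <= b ->
    geodesic `[a, b] gamma ->
    (exists2 h, H h & gamma a = vertex S h) ->
    (exists2 h, H h & gamma b = vertex S h) ->
    morse M `[a, b] gamma /\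
    gamma @` `[a, b] `<=` neighbourhood mu (vertex S @` H).

Definition stable_subgroup (R : realType) (G : groupType) (H : set G) : Prop :=
  is_subgroup H /\
  exists (S : generating_set G) (M : R -> R -> R) (mu : R),
    [/\ morse_gauge M, 0 <= mu & stable_wrt S M mu H].

(* Main.v *)
Require Import Defs.
From mathcomp Require Import all_boot all_order all_algebra.
From mathcomp Require Import all_classical all_reals all_analysis.
From mathcomp Require Import zify ring lra.

(* By induction on the number of factors.  Let P be the product of all but the
   last two subgroups H, K, let g be outside PHK and let I = H ∩ K.  For a
   finite index normal subgroup N, the subgroups H' = H ∩ IN and K' = K ∩ IN
   contain I and have finite index in H and K.  If all short elements of IN lie
   in I, which can be achieved since I is separable, then a product of elements
   of H' \ I and K' \ I taken alternately and made shortest in their cosets of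
   I labels a concatenation of geodesics whose short subpaths are uniformly
   Morse quasigeodesics.  By the local-to-global property the whole path is a
   Morse quasigeodesic, hence E = <H', K'> is stable.  As PHK is covered by
   finitely many sets P h E k, which are separable by induction, it remains to
   choose N so that g is in none of the sets P h E k with h in H and k in K.
   If g is in one of them, then g = p x_1 x_2 ... x_m with p in P, x_1 in H, x_m in K, and the
   other x_i taken alternately in K' \ I and H' \ I.  If m > 2, this gives a
   polygon with one quasigeodesic side, running from p to g, and sides in
   cosets of the factors of P (going from p back to 1); since |g| is fixed,
   the quasigeodesic side is close to the others.  Hence x_2 lies in a set Q,
   taken from a finite family which does not depend on N, which is a product of
   cosets of factors of P, and x_2 can be replaced by any element of Q at the
   expense of changing p.  By induction IQ is separable, so that N can be chosen
   such that IN meets Q only if I does.  Then x_2 can be replaced by an element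
   of I, which merges with x_1 and x_3, and m decreases. *)

Set Implicit Arguments.
Unset Strict Implicit.
Unset Printing Implicit Defensive.

Import Order.TTheory GRing.Theory Num.Theory.

Local Open Scope classical_set_scope.

(** * Finite index subgroups and separable sets *)

Section FiniteIndex.
Context {G : groupType}.
Implicit Types (H K N A : set G).
Local Open Scope group_scope.

Definition normal_fi N : Prop :=
  [/\ is_subgroup N, finite_index N & forall x y, N x -> N (y^-1 * x * y)].

Lemma finite_reps N A : finite_index N ->
  exists F : set G, [/\ finite_set F, F `<=` A &
    forall a, A a -> exists2 f, F f & lcoset_of a N = lcoset_of f N].
Proof.
move=> fN; pose C := [set lcoset_of x N | x in A].
have fC : finite_set C by apply: sub_finite_set fN => _ [x _ <-]; exists x.
(* The default 1 is never reached on [C], since each coset there comes from an element of A. *)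
pose c (B : set G) := xget 1 [set x | A x /\ lcoset_of x N = B].
have cP x : A x -> A (c (lcoset_of x N)) /\ lcoset_of (c (lcoset_of x N)) N = lcoset_of x N.
  by move=> Ax; rewrite /c; case: xgetP => [y -> //|/(_ x)] []; split.
exists (c @` C); split; first exact: finite_image.
  by move=> _ [_ [x Ax <-] <-]; case: (cP x Ax).
move=> a Aa; exists (c (lcoset_of a N)); last by case: (cP a Aa).
by exists (lcoset_of a N) => //; exists a.
Qed.

Lemma finite_coset_reps N A : is_subgroup N -> finite_index N ->
  exists F : set G, [/\ finite_set F, F `<=` A &
    forall a, A a -> exists2 f, F f & N (f^-1 * a)].
Proof.
move=> sN fN; have [F [fF FA HF]] := finite_reps A fN.
exists F; split => // a /HF[f Ff eqf]; exists f => //.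
by have : lcoset_of a N a; [exact: lcoset_of_refl|rewrite eqf => -[n Nn <-]; rewrite mulKg].
Qed.

Lemma finite_index_setT : finite_index (setT : set G).
Proof.
apply: (@sub_finite_set _ _ [set setT]) => //.
move=> _ [y _ <-]; apply/seteqP; split => // z _.
by exists (y^-1 * z) => //; rewrite mulVKg.
Qed.

Lemma normal_fiT : normal_fi (setT : set G).
Proof. by split=> //; exact: finite_index_setT. Qed.

Lemma normal_fiI H K : normal_fi H -> normal_fi K -> normal_fi (H `&` K).
Proof.
move=> [sH fH nH] [sK fK nK]; split; [exact: is_subgroupI|exact: finite_indexI|].
by move=> x y [Hx Kx]; split; [exact: nH|exact: nK].
Qed.

Definition conj_by (x : G) H : set G := [set x * h * x^-1 | h in H].

Lemma conj_byE x H y : conj_by x H y <-> H (x^-1 * y * x).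
Proof.
split=> [[h Hh <-]|Hy]; first by rewrite -!mulgA mulVg mulg1 mulKg.
by exists (x^-1 * y * x) => //; rewrite !mulgA mulgV mul1g mulgK.
Qed.

Lemma is_subgroup_conj x H : is_subgroup H -> is_subgroup (conj_by x H).
Proof.
move=> [H1 HM HV]; split.
- by apply/conj_byE; rewrite mulg1 mulVg.
- move=> y z /conj_byE Hy /conj_byE Hz; apply/conj_byE.
  by have := HM _ _ Hy Hz; rewrite !mulgA mulgK.
- by move=> y /conj_byE /HV; rewrite !invgM invgK mulgA => Hy; apply/conj_byE.
Qed.

Lemma finite_index_conj x H : finite_index H -> finite_index (conj_by x H).
Proof.
move=> /(finite_image (fun B : set G => [set b * x^-1 | b in B])).
apply: sub_finite_set => _ [y _ <-]; exists (lcoset_of (y * x) H).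
  by exists (y * x).
apply/seteqP; split.
  by move=> _ [_ [h Hh <-] <-]; exists (x * h * x^-1); [exists h|rewrite !mulgA].
by move=> _ [_ [h Hh <-] <-]; exists (y * x * h); [exists h|rewrite !mulgA].
Qed.

(** The core is the intersection of all conjugates of K. As x K x^-1 depends only on the coset x K,
    finitely many conjugates suffice. *)
Lemma normal_core K : is_subgroup K -> finite_index K ->
  exists N, normal_fi N /\ N `<=` K.
Proof.
move=> sK fK; have [F [/finite_seqP[s ->] _ HF]] := finite_reps setT fK.
have conjE x y : lcoset_of x K = lcoset_of y K -> conj_by x K = conj_by y K.
  move=> xy; have : lcoset_of y K x by rewrite -xy; exact: lcoset_of_refl.
  case: sK => _ KM KV [k Kk <-]; apply/seteqP; split=> z /conj_byE Kz; apply/conj_byE.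
    have := KM _ _ (KM _ _ Kk Kz) (KV _ Kk).
    by rewrite invgM -!mulgA mulgV mulg1 mulVKg.
  have := KM _ _ (KM _ _ (KV _ Kk) Kz) Kk.
  by rewrite invgM -!mulgA.
pose N := [set x | forall y, conj_by y K x].
have NE : N = \big[setI/setT]_(y <- s) conj_by y K.
  apply/seteqP; split=> [x Nx|x].
    by rewrite -bigcap_seq => y _; exact: Nx.
  rewrite -bigcap_seq => Nx y; have [f fs yf] := HF y I.
  by rewrite (conjE _ _ yf); exact: Nx.
exists N; split; last by move=> x /(_ 1) /conj_byE; rewrite invg1 mul1g mulg1.
split.
- rewrite NE; apply: big_ind; [by []|exact: is_subgroupI|].
  by move=> y _; exact: is_subgroup_conj.
- rewrite NE; apply: big_ind;
    [exact: finite_index_setT|exact: finite_indexI|].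
  by move=> y _; exact: finite_index_conj.
- move=> x y Nx z; apply/conj_byE; have /conj_byE := Nx (y * z).
  by rewrite invgM !mulgA.
Qed.

(** A basic neighbourhood of g is a coset g K, and it contains g N for the normal core N of K. *)
Lemma separableP A : separable A <->
  forall g, ~ A g -> exists N, normal_fi N /\ forall n, N n -> ~ A (g * n).
Proof.
have -> : separable A <-> open (~` A : set (profinite G)) by rewrite openC.
split.
  move=> [/= D DF DA] g Ag.
  have [B DB Bg] : (\bigcup_(i in D) i) g by rewrite DA.
  have [x [K [sK fK BE]]] := DF _ DB.
  have [N [nN NK]] := normal_core sK fK; exists N; split => // n Nn.
  suff : (~` A) (g * n) by [].
  rewrite -DA; exists B => //.
  move: Bg; rewrite BE => /(lcoset_of_eq sK) ->.
  by exists n => //; exact: NK.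
move=> HA.
exists [set B | finite_index_cosets B /\ B `<=` ~` A]; first by move=> B [].
apply/seteqP; split=> [g [B [_ BA] /BA//]|g /HA[N [[sN fN _] NA]]].
exists (lcoset_of g N); last exact: lcoset_of_refl.
by split; [exists g, N|move=> _ [n Nn <-]; exact: NA].
Qed.

(** The subgroups obtained for the single sets are intersected. Both choices of a finite index
    subgroup in the induction on the number of factors are made in this way. *)
Lemma separable_common_nbhd (F : set (set G)) g : finite_set F ->
  (forall A, F A -> separable A /\ ~ A g) ->
  exists N, normal_fi N /\ forall A n, F A -> N n -> ~ A (g * n).
Proof.
move=> /finite_seqP[s ->]; elim: s => [|A s IH] HF.
  by exists setT; split => //; exact: normal_fiT.
have [N [nN HN]] : exists N, normal_fi N /\ forall B n, B \in s -> N n -> ~ B (g * n).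
  by apply: IH => B Bs; apply: HF; rewrite /= inE Bs orbT.
have [sA nAg] : separable A /\ ~ A g by apply: HF; rewrite /= inE eqxx.
have [N' [nN' HN']] := (separableP A).1 sA g nAg.
exists (N `&` N'); split; first exact: normal_fiI.
move=> B n; rewrite /= inE => /orP[/eqP ->|Bs] [Nn N'n]; first exact: HN'.
exact: HN.
Qed.

Definition rtrans A (x : G) : set G := [set a * x | a in A].

Lemma rtransE A x y : rtrans A x y <-> A (y * x^-1).
Proof.
split=> [[a Aa <-]|Ay]; first by rewrite mulgK.
by exists (y * x^-1) => //; rewrite mulgVK.
Qed.

(** One has g n x^-1 = (g x^-1) (x n x^-1), and x n x^-1 stays in N by normality. *)
Lemma separable_rtrans A x : separable A -> separable (rtrans A x).
Proof.
move=> /separableP HA; apply/separableP => g /rtransE /HA[N [nN NA]].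
exists N; split => // n Nn /rtransE Agn.
case: nN => _ _ nN; apply: (NA (x * n * x^-1)); last by rewrite !mulgA mulgVK.
by have := nN n x^-1 Nn; rewrite invgK.
Qed.

(** A product over a list rather than over ['I_n], so that factors can be split off at either
    end. *)
Fixpoint sprod (Hs : seq (set G)) : set G :=
  if Hs is H :: Hs' then [set h * p | h in H & p in sprod Hs'] else [set 1].

Lemma sprod_cat Hs Ks x : sprod (Hs ++ Ks) x <->
  exists p q, [/\ sprod Hs p, sprod Ks q & x = p * q].
Proof.
elim: Hs x => [|H Hs IH] x /=.
  split; first by exists 1, x; rewrite mul1g.
  by move=> [_ [q [-> Kq ->]]]; rewrite mul1g.
split.
  move=> [h Hh [_ /IH[p [q [Hp Kq ->]]] <-]].
  by exists (h * p), q; split => //; [exists h => //; exists p|rewrite mulgA].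
move=> [_ [q [[h Hh [p Hp <-]] Kq ->]]]; exists h => //; exists (p * q).
  by apply/IH; exists p, q.
by rewrite mulgA.
Qed.

Lemma sprod_rcons Hs K x : sprod (rcons Hs K) x <->
  exists p q, [/\ sprod Hs p, K q & x = p * q].
Proof.
rewrite -cats1; split=> [/sprod_cat[p [_ [Hp [q Kq [_ -> <-]] ->]]]|].
  by exists p, q; rewrite mulg1.
move=> [p [q [Hp Kq ->]]]; apply/sprod_cat; exists p, q; split => //.
by exists q => //; exists 1 => //; rewrite mulg1.
Qed.

Lemma sprod_rev Hs x : (forall H, H \in Hs -> is_subgroup H) ->
  sprod Hs x -> sprod (rev Hs) x^-1.
Proof.
elim: Hs x => [|H Hs IH] x sH /=; first by move=> ->; rewrite invg1.
move=> [h Hh [p Hp <-]]; rewrite rev_cons; apply/sprod_rcons.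
exists p^-1, h^-1; split; last by rewrite invgM.
  by apply: IH => // K Ks; apply: sH; rewrite inE Ks orbT.
by have [|_ _ +] := sH H; [rewrite inE eqxx|apply].
Qed.

End FiniteIndex.

(** * Word metrics and discrete quasigeodesics *)

Section WordMetric.
Context {G : groupType} (S : generating_set G).
Local Open Scope group_scope.

Definition letter (x : G) : Prop := gens S x \/ gens S x^-1.

Definition word_of (x : G) (n : nat) : Prop :=
  exists s : seq G, [/\ size s = n, forall y, y \in s -> letter y & \prod_(y <- s) y = x].

Lemma word_of_mul x y m n : word_of x m -> word_of y n -> word_of (x * y) (m + n)%N.
Proof.
move=> [s [<- ls <-]] [t [<- lt <-]]; exists (s ++ t); split.
- by rewrite size_cat.
- by move=> z; rewrite mem_cat => /orP[/ls|/lt].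
- by rewrite big_cat.
Qed.

Lemma letterV x : letter x -> letter x^-1.
Proof. by case; [right; rewrite invgK|left]. Qed.

Lemma word_ofV x n : word_of x n -> word_of x^-1 n.
Proof.
move=> [s [<- ls <-]]; elim: s ls => [|y s IH] ls.
  by exists [::]; split => //; rewrite !big_nil invg1.
have {}IH := IH (fun z zs => ls z (mem_behead (s := y :: s) zs)).
rewrite big_cons invgM /= -addn1; apply: word_of_mul IH _.
exists [:: y^-1]; split => //; last by rewrite big_seq1.
by move=> z; rewrite inE => /eqP ->; apply/letterV/ls; rewrite inE eqxx.
Qed.

Lemma word_of_exists x : exists n, `[< word_of x n >].
Proof.
pose A := [set x | exists n, `[< word_of x n >]].
have : smallest is_subgroup (gens S) x by rewrite gens_generate.
move/(_ A); apply; split; last first.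
  move=> y Sy; exists 1%N; apply/asboolP; exists [:: y]; split => //.
    by move=> z; rewrite inE => /eqP ->; left.
  by rewrite big_seq1.
split.
- by exists 0%N; apply/asboolP; exists [::]; split => //; rewrite big_nil.
- move=> y z [m /asboolP my] [n /asboolP nz]; exists (m + n); apply/asboolP.
  exact: word_of_mul.
- by move=> y [n /asboolP ny]; exists n; apply/asboolP; exact: word_ofV.
Qed.

Definition wlen (x : G) : nat := ex_minn (word_of_exists x).

Lemma wlen_word x : word_of x (wlen x).
Proof. by rewrite /wlen; case: ex_minnP => n /asboolP. Qed.

Lemma wlen_le x n : word_of x n -> (wlen x <= n)%N.
Proof. by rewrite /wlen; case: ex_minnP => m _ + xn; apply; exact/asboolP. Qed.

Lemma wlen1 : wlen 1 = 0.
Proof.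
apply/eqP; rewrite -leqn0; apply: wlen_le.
by exists [::]; split => //; rewrite big_nil.
Qed.

Lemma wlen0 x : wlen x = 0 -> x = 1.
Proof.
move=> x0; have := wlen_word x; rewrite x0 => -[s [/size0nil -> _ <-]].
by rewrite big_nil.
Qed.

Lemma wlenM x y : (wlen (x * y) <= wlen x + wlen y)%N.
Proof. by apply: wlen_le; apply: word_of_mul; exact: wlen_word. Qed.

Lemma wlenV x : wlen x^-1 = wlen x.
Proof.
have H y : (wlen y^-1 <= wlen y)%N by apply: wlen_le; apply: word_ofV; exact: wlen_word.
by apply/eqP; rewrite eqn_leq H -{1}(invgK x) H.
Qed.

Lemma wlen_letter x : letter x -> (wlen x <= 1)%N.
Proof.
move=> lx; apply: wlen_le; exists [:: x]; split => //; last by rewrite big_seq1.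
by move=> y; rewrite inE => /eqP ->.
Qed.

Definition ball (D : nat) : set G := [set x | (wlen x <= D)%N].

Lemma finite_ball D : finite_set (ball D).
Proof.
elim: D => [|D IH].
  apply: (@sub_finite_set _ _ [set 1]) => // x; rewrite /ball /= leqn0 => /eqP.
  exact: wlen0.
have fl : finite_set letter.
  have fS := gens_finite S.
  apply: (@sub_finite_set _ _ (gens S `|` [set x^-1 | x in gens S])).
    by move=> x [|] Sx; [left|right; exists x^-1 => //; rewrite invgK].
  by rewrite finite_setU; split => //; exact: finite_image.
have fI := finite_image2 (fun x y : G => x * y) fl IH.
apply: (@sub_finite_set _ _ (ball D `|` [set x * y | x in letter & y in ball D])).
  move=> x; rewrite /ball /= leq_eqVlt => /orP[/eqP xD|xD]; last by left.
  right; have := wlen_word x; rewrite xD => -[[|y s] [//= [sD] ls <-]].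
  exists y; first by apply: ls; rewrite inE eqxx.
  exists (\prod_(z <- s) z); last by rewrite big_cons.
  apply: wlen_le; exists s; split => // z zs; apply: ls.
  by rewrite inE zs orbT.
by rewrite finite_setU.
Qed.

Definition wd (x y : G) : nat := wlen (x^-1 * y).

Lemma wdC x y : wd x y = wd y x.
Proof. by rewrite /wd -wlenV invgM invgK. Qed.

Lemma wdxx x : wd x x = 0.
Proof. by rewrite /wd mulVg wlen1. Qed.

Lemma wd_tri y x z : (wd x z <= wd x y + wd y z)%N.
Proof. by apply: leq_trans (wlenM _ _); rewrite -mulgA mulVKg. Qed.

Lemma wd_mul g x y : wd (g * x) (g * y) = wd x y.
Proof. by rewrite /wd invgM -mulgA mulKg. Qed.

Lemma wd1 x : wd 1 x = wlen x.
Proof. by rewrite /wd invg1 mul1g. Qed.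

Lemma wdM x y : wd x (x * y) = wlen y.
Proof. by rewrite /wd mulKg. Qed.

(** The points are the prefixes of a shortest word. The sequence is constant after its end, which is
    why a step may be trivial. A distance below j - i would yield a shorter word for x. *)
Lemma geodesic_exists x : exists v : nat -> G, [/\ v 0 = 1, v (wlen x) = x,
  forall i, letter ((v i)^-1 * v i.+1) \/ v i = v i.+1 &
  forall i j, (i <= j <= wlen x)%N -> wd (v i) (v j) = (j - i)%N].
Proof.
have [s [ss ls sx]] := wlen_word x.
pose v i := \prod_(y <- take i s) y.
have v0 : v 0 = 1 by rewrite /v take0 big_nil.
have vx : v (wlen x) = x by rewrite /v -ss take_size.
have vS i : letter ((v i)^-1 * v i.+1) \/ v i = v i.+1.
  rewrite /v; have [si|ltis] := leqP (size s) i.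
    by right; rewrite !take_oversize// leqW.
  left; rewrite (take_nth 1 ltis) -cats1 big_cat big_seq1 /= mulKg.
  by apply: ls; exact: mem_nth.
have vle i k : (wd (v i) (v (i + k)) <= k)%N.
  elim: k => [|k IH]; first by rewrite addn0 wdxx.
  apply: leq_trans (wd_tri (v (i + k)) _ _) _.
  rewrite -addn1 leq_add// addnA addn1.
  case: (vS (i + k)%N) => [/wlen_letter//|->]; by rewrite wdxx.
exists v; split => // i j /andP[ij jx].
have := vle i (j - i)%N; rewrite subnKC// => dij.
have := vle 0 i; have := vle j (wlen x - j)%N; rewrite add0n subnKC// v0 vx => d2 d1.
have := wd_tri (v j) 1 x; have := wd_tri (v i) 1 (v j); have := wd1 x.
lia.
Qed.

Definition geo (x : G) : nat -> G := projT1 (cid (geodesic_exists x)).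

Lemma geo0 x : geo x 0 = 1.
Proof. by rewrite /geo; case: cid => v []. Qed.
Lemma geo_end x : geo x (wlen x) = x.
Proof. by rewrite /geo; case: cid => v []. Qed.
Lemma geo_step x i : letter ((geo x i)^-1 * geo x i.+1) \/ geo x i = geo x i.+1.
Proof. by rewrite /geo; case: cid => v []. Qed.
Lemma geo_wd x i j : (i <= j <= wlen x)%N -> wd (geo x i) (geo x j) = (j - i)%N.
Proof. by rewrite /geo; case: cid => v [] /= _ _ _; apply. Qed.

End WordMetric.

(** * Quasigeodesic sequences: perturbation, padding and cutting at a nearest point *)

Section QuasiGeodesics.
Context {G : groupType} (S : generating_set G).
Local Notation wd := (wd S).
Local Notation wlen := (wlen S).
Local Notation geo := (geo S).
Implicit Types (q u v : nat -> G) (k N i j D : nat).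

(* A quasi-isometric embedding of {0, ..., N}.  There is no condition on the
   steps, so that moving the points by a bounded amount only affects k. *)
Definition qg k N q : Prop := forall i j, (i <= j <= N)%N ->
  (wd (q i) (q j) <= k * (j - i) + k)%N /\ (j - i <= k * wd (q i) (q j) + k)%N.

Lemma qg_mono k k' N q : (k <= k')%N -> qg k N q -> qg k' N q.
Proof.
move=> kk Q i j ij; have [h1 h2] := Q i j ij; split.
  by rewrite (leq_trans h1)// leq_add// leq_mul.
by rewrite (leq_trans h2)// leq_add// leq_mul.
Qed.

Lemma qg_eq k N q q' : (forall i, (i <= N)%N -> q i = q' i) -> qg k N q -> qg k N q'.
Proof.
move=> e Q i j ij; case/andP: (ij) => ij' jN; rewrite -!e //; first exact: Q.
exact: leq_trans jN.
Qed.

Lemma qg_sub k N q a b : (a <= b <= N)%N -> qg k N q ->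
  qg k (b - a) (fun i => q (a + i)%N).
Proof.
move=> /andP[ab bN] Q i j /andP[ij jN].
by rewrite -(subnDl a); apply: Q; lia.
Qed.

Lemma qg_rev k N q : qg k N q -> qg k N (fun i => q (N - i)%N).
Proof.
move=> Q i j /andP[ij jN]; rewrite wdC.
have e : (N - i - (N - j) = j - i)%N by lia.
by rewrite -e; apply: Q; rewrite leq_subr leq_sub2l.
Qed.

Lemma qg_mul k N q g : qg k N q -> qg k N (fun i => (g * q i)%g).
Proof. by move=> Q i j ij; rewrite wd_mul; exact: Q. Qed.

Lemma qg_geo x : qg 1 (wlen x) (geo x).
Proof. by move=> i j ij; rewrite geo_wd// mul1n leq_addr. Qed.

Lemma qg_pert k N q q' D : qg k N q ->
  (forall i, (i <= N)%N -> (wd (q i) (q' i) <= D)%N) ->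
  qg (k + 2 * D * k + 2 * D) N q'.
Proof.
move=> Q dq i j /andP[ij jN]; have [h1 h2] : _ /\ _ := Q i j (introT andP (conj ij jN)).
have di := dq i (leq_trans ij jN); have dj := dq j jN.
have t1 := wd_tri S (q i) (q' i) (q' j); have t2 := wd_tri S (q j) (q i) (q' j).
have t3 := wd_tri S (q' i) (q i) (q j); have t4 := wd_tri S (q' j) (q' i) (q j).
rewrite (wdC _ (q' i) (q i)) in t1; rewrite (wdC _ (q' j) (q j)) in t4.
have t5 : (wd (q i) (q j) <= D + wd (q' i) (q' j) + D)%N by lia.
split.
  by have : (0 <= D * k * (j - i))%N by []; nia.
have : (k * wd (q i) (q j) <= k * (D + wd (q' i) (q' j) + D))%N by rewrite leq_mul2l t5 orbT.
by have : (0 <= D * k * wd (q' i) (q' j))%N by []; nia.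
Qed.

(** Prescribes new endpoints at bounded cost: the point [q i] moves to index i + 1, and b sits at
    index N + 2. *)
Definition pad (a : G) N q (b : G) : nat -> G :=
  fun t => if t == 0%N then a else if (t <= N.+1)%N then q t.-1 else b.

Lemma pad_in a N q b i : (i <= N)%N -> pad a N q b i.+1 = q i.
Proof. by move=> iN; rewrite /pad ltnS iN. Qed.

Lemma pad_end a N q b : pad a N q b N.+2 = b.
Proof. by rewrite /pad ltnn. Qed.

Lemma pad_cases a N q b t : (t <= N.+2)%N ->
  [\/ t = 0%N /\ pad a N q b t = a, t = N.+2 /\ pad a N q b t = b
    | exists2 i, (i <= N)%N & t = i.+1 /\ pad a N q b t = q i].
Proof.
case: t => [|t] tN; first by constructor 1.
have [tN'|tN'] := leqP t N.
  by constructor 3; exists t => //; rewrite pad_in.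
by constructor 2; have -> : t = N.+1 by [lia]; rewrite pad_end.
Qed.

Lemma qg_pad k N q D a b : qg k N q -> (wd a (q 0%N) <= D)%N ->
  (wd (q N) b <= D)%N ->
  qg (k + 2 + 2 * D * (k + 2) + 2 * D) N.+2 (pad a N q b).
Proof.
move=> Q qa qb; apply: (@qg_pert _ _ (fun t => q (minn t.-1 N))) => [i j ij|i iN].
  have [h1 h2] := Q (minn i.-1 N) (minn j.-1 N) ltac:(lia).
  set d := wd _ _ in h1 h2 *; split.
    apply: leq_trans h1 _.
    have : (k * (minn j.-1 N - minn i.-1 N) <= k * (j - i))%N by rewrite leq_mul2l; lia.
    by rewrite mulnDl; lia.
  by have : (j - i <= minn j.-1 N - minn i.-1 N + 2)%N by [lia]; rewrite mulnDl; lia.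
have [[-> ->]|[-> ->]|[t tN [-> ->]]] := pad_cases a q b iN.
- by rewrite min0n wdC.
- by have -> : minn N.+2.-1 N = N by [lia].
- by have -> : minn t.+1.-1 N = t by [lia]; rewrite wdxx.
Qed.

Definition concat n u v : nat -> G :=
  fun t => if (t <= n)%N then u t else v (t - n)%N.

Lemma nearest (e : G) N q : exists2 r, (r <= N)%N &
  forall i, (i <= N)%N -> (wd e (q r) <= wd e (q i))%N.
Proof.
have := @arg_minnP 'I_N.+1 ord0 predT (fun i : 'I_N.+1 => wd e (q (val i))) erefl.
case=> r _ Hr; exists r; first by have := ltn_ord r; rewrite ltnS.
by move=> i iN; have := Hr (Ordinal (iN : (i < N.+1)%N)) erefl.
Qed.

(** A geodesic from e to its nearest point on q, continued along q, is again a quasigeodesic: a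
    point of the geodesic at distance s from [q r] has distance at least s from all of q, since
    otherwise [q r] would not be nearest to e. *)
Lemma qg_nearest k N q (e : G) r : qg k N q -> (r <= N)%N ->
  (forall i, (i <= N)%N -> (wd e (q r) <= wd e (q i))%N) ->
  qg (2 * k + 1) (wd e (q r) + (N - r))
    (concat (wd e (q r)) (fun t => (e * geo (e^-1 * q r)%g t)%g)
      (fun t => q (r + t)%N)).
Proof.
move=> Q rN Hr; set l := wd e (q r) => i j /andP[ij jN].
set u := (fun t => (e * _)%g).
have ul : u l = q r by rewrite /u geo_end mulVKg.
have uu a b : (a <= b <= l)%N -> wd (u a) (u b) = (b - a)%N.
  by move=> ab; rewrite /u wd_mul geo_wd.
have ue : u 0%N = e by rewrite /u geo0 mulg1.
rewrite /concat; case: (leqP i l) => il; case: (leqP j l) => jl.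
- rewrite uu ?ij//; split; nia.
- set j' := (j - l)%N; have j'N : (r + j' <= N)%N by rewrite /j'; lia.
  have [h1 h2] := Q r (r + j')%N ltac:(lia).
  have e1 := Hr _ j'N.
  have t1 := wd_tri S (u i) e (q (r + j')%N).
  have t2 := wd_tri S (u i) (q r) (q (r + j')%N).
  have t3 := wd_tri S (q r) (u i) (q (r + j')%N).
  have e2 : wd (u i) (q r) = (l - i)%N by rewrite -ul uu// il leqnn.
  have e3 : wd e (u i) = i by rewrite -ue uu ?subn0//= leq0n.
  rewrite (wdC S (q r) (u i)) e2 in t2; rewrite e2 in t3; rewrite e3 in t1.
  have ji : (j - i = (l - i) + j')%N by rewrite /j'; lia.
  have e4 : (r + j' - r = j')%N by lia.
  rewrite e4 in h1 h2; rewrite ji.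
  set d := wd (u i) _ in t1 t2 t3 *; set d' := wd (q r) _ in h1 h2 t2 t3.
  have dl : (l - i <= d)%N by move: e1; rewrite -/l; lia.
  split; first nia.
  have : (d' <= 2 * d)%N by lia.
  nia.
- by exfalso; lia.
- have [h1 h2] := Q (r + (i - l))%N (r + (j - l))%N ltac:(lia).
  have e4 : (r + (j - l) - (r + (i - l)) = j - i)%N by lia.
  rewrite e4 in h1 h2; split; nia.
Qed.

End QuasiGeodesics.

(** * Discrete stability *)

Section DiscreteStability.
Context {G : groupType} (S : generating_set G).
Local Notation wd := (wd S).
Local Notation wlen := (wlen S).
Local Notation qg := (qg S).
Implicit Types (q u v : nat -> G) (k N i j D : nat) (H K A : set G).

Definition near_set A D (x : G) : Prop := exists2 a, A a & (wd x a <= D)%N.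

Lemma near_set_le A D D' x : (D <= D')%N -> near_set A D x -> near_set A D' x.
Proof. by move=> DD [a Aa xa]; exists a => //; exact: leq_trans DD. Qed.

Lemma near_set_mem A D x : A x -> near_set A D x.
Proof. by exists x => //; rewrite wdxx. Qed.

Lemma near_set_trans A D D' x y : (wd x y <= D')%N -> near_set A D y ->
  near_set A (D' + D) x.
Proof.
move=> xy [a Aa ya]; exists a => //.
by apply: leq_trans (wd_tri S y _ _) _; rewrite leq_add.
Qed.

Definition fellow D N q N' q' : Prop :=
  forall i, (i <= N)%N -> exists2 j, (j <= N')%N & (wd (q i) (q' j) <= D)%N.

Definition hausdorff_close D N q N' q' : Prop := fellow D N q N' q' /\ fellow D N' q' N q.

Lemma fellow_le D D' N q N' q' : (D <= D')%N ->
  fellow D N q N' q' -> fellow D' N q N' q'.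
Proof. by move=> DD F i /F[j jN ij]; exists j => //; exact: leq_trans DD. Qed.

Lemma hausdorff_close_le D D' N q N' q' : (D <= D')%N ->
  hausdorff_close D N q N' q' -> hausdorff_close D' N q N' q'.
Proof. by move=> DD [F F']; split; exact: fellow_le DD _. Qed.

Lemma fellow_trans D D' N q N' q' N'' q'' : fellow D N q N' q' ->
  fellow D' N' q' N'' q'' -> fellow (D + D') N q N'' q''.
Proof.
move=> F F' i /F[j /F'[l lN jl] ij]; exists l => //.
by apply: leq_trans (wd_tri S (q' j) _ _) _; rewrite leq_add.
Qed.

(* Equivalent to stability for subgroups.  As only quasigeodesics with endpoints
   in H are involved, this does not depend on S and is inherited by conjugates
   and intersections. *)
Definition dstable H : Prop := forall k, exists D, forall N q,
  qg k N q -> H (q 0%N) -> H (q N) ->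
  (forall i, (i <= N)%N -> near_set H D (q i)) /\
  (forall N' q', qg k N' q' -> q' 0%N = q 0%N -> q' N' = q N ->
    fellow D N q N' q').

Lemma near_set_mul H D g x : near_set (lcoset_of g H) D (g * x)%g <-> near_set H D x.
Proof.
split=> [[_ [h Hh <-]]|[h Hh xh]]; first by rewrite wd_mul; exists h.
by exists (g * h)%g; [exists h|rewrite wd_mul].
Qed.

Lemma near_set_mulV H D g x : near_set H D (g^-1 * x)%g <-> near_set (lcoset_of g H) D x.
Proof. by rewrite -(near_set_mul H D g) mulVKg. Qed.

Lemma fellow_mul D g N q N' q' :
  fellow D N (fun i => g * q i)%g N' (fun i => g * q' i)%g <-> fellow D N q N' q'.
Proof.
by split=> F i /F[j jN ij]; exists j => //; move: ij; rewrite wd_mul.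
Qed.

Lemma hausdorff_close_mul D g N q N' q' :
  hausdorff_close D N (fun i => g * q i)%g N' (fun i => g * q' i)%g <-> hausdorff_close D N q N' q'.
Proof. by rewrite /hausdorff_close !fellow_mul. Qed.

Lemma fellow_pad D D' a b N q N' q' : (wd a (q' 0%N) <= D')%N ->
  (wd b (q' N') <= D')%N -> fellow D N.+2 (pad a N q b) N'.+2 (pad a N' q' b) ->
  fellow (D + D') N q N' q'.
Proof.
move=> da db F i iN; have [|j jN] := F i.+1; first by rewrite ltnS leqW.
rewrite pad_in//.
have [[_ ->]|[_ ->]|[l lN [_ ->]]] := pad_cases a q' b jN => d.
- by exists 0%N => //; have := wd_tri S a (q i) (q' 0%N); lia.
- by exists N' => //; have := wd_tri S b (q i) (q' N'); lia.
- by exists l => //; lia.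
Qed.

(** The endpoints are moved into H by padding q and q' with the same two elements a and b of H. The
    start of q' is within 2 D0 of a, whence [D2]. *)
Lemma dstable_fellow1 H k D0 : dstable H -> exists D, forall N q,
  qg k N q -> near_set H D0 (q 0%N) -> near_set H D0 (q N) ->
  (forall i, (i <= N)%N -> near_set H D (q i)) /\
  (forall N' q', qg k N' q' -> (wd (q 0%N) (q' 0%N) <= D0)%N ->
     (wd (q N) (q' N') <= D0)%N -> fellow D N q N' q').
Proof.
pose D2 := (2 * D0)%N; pose k' := (k + 2 + 2 * D2 * (k + 2) + 2 * D2)%N.
move=> /(_ k')[D HD]; exists (D + D2)%N => N q Q [a Ha qa] [b Hb qb].
have padP N' q' : qg k N' q' -> (wd (q 0%N) (q' 0%N) <= D0)%N ->
    (wd (q N) (q' N') <= D0)%N ->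
    [/\ wd a (q' 0%N) <= D2, wd b (q' N') <= D2 & qg k' N'.+2 (pad a N' q' b)]%N.
  move=> Q' d0 dN.
  have da : (wd a (q' 0%N) <= D2)%N.
    by have := wd_tri S (q 0%N) a (q' 0%N); rewrite (wdC S a (q 0%N)) /D2; lia.
  have db : (wd b (q' N') <= D2)%N.
    by have := wd_tri S (q N) b (q' N'); rewrite (wdC S b (q N)) /D2; lia.
  by split => //; apply: qg_pad => //; rewrite wdC.
have [|||near_p fel_p] := HD N.+2 (pad a N q b).
- by have [||] := padP N q Q _ _; rewrite ?wdxx.
- by [].
- by rewrite pad_end.
split=> [i iN|N' q' Q' d0 dN].
  have [|h Hh] := near_p i.+1; first by rewrite ltnS leqW.
  by rewrite pad_in// => d; exists h => //; lia.
have [da db Qp] := padP _ _ Q' d0 dN.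
by apply: (fellow_pad da db); apply: fel_p; rewrite ?pad_end.
Qed.

Lemma dstable_fellow H k D0 : dstable H -> exists D, forall g N q,
  qg k N q -> near_set (lcoset_of g H) D0 (q 0%N) ->
  near_set (lcoset_of g H) D0 (q N) ->
  (forall i, (i <= N)%N -> near_set (lcoset_of g H) D (q i)) /\
  (forall N' q', qg k N' q' -> (wd (q 0%N) (q' 0%N) <= D0)%N ->
     (wd (q N) (q' N') <= D0)%N -> fellow D N q N' q').
Proof.
move=> /(dstable_fellow1 k D0)[D HD]; exists D => g N q Q.
move=> /near_set_mulV q0 /near_set_mulV qN.
have [nq fq] := HD N (fun i => g^-1 * q i)%g (qg_mul _ Q) q0 qN.
split=> [i /nq /near_set_mulV//|N' q' Q' d0 dN].
by apply/(fellow_mul _ g^-1); apply: fq; rewrite ?wd_mul//; exact: qg_mul.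
Qed.

(** [dstable_fellow] is applied to both orders of q and q'. The endpoints of q' are within D0 + D0
    of the coset. *)
Lemma dstable_hausdorff_close H k D0 : dstable H ->
  exists D, forall g N q N' q', qg k N q -> qg k N' q' ->
  near_set (lcoset_of g H) D0 (q 0%N) -> near_set (lcoset_of g H) D0 (q N) ->
  (wd (q 0%N) (q' 0%N) <= D0)%N -> (wd (q N) (q' N') <= D0)%N ->
  hausdorff_close D N q N' q'.
Proof.
move=> dH; have [D HD] := dstable_fellow k (D0 + D0) dH.
exists D => g N q N' q' Q Q' n0 nN d0 dN; split.
  have [||_] := HD g _ _ Q; [by apply: near_set_le n0; lia|by apply: near_set_le nN; lia|].
  by apply => //; lia.
have [||_] := HD g _ _ Q'; [by apply: near_set_trans n0; rewrite wdC|by apply: near_set_trans nN; rewrite wdC|].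
by apply => //; rewrite wdC; lia.
Qed.

Lemma finite_nat_bound (T : choiceType) (A : set T) (f : T -> nat) :
  finite_set A -> exists D, forall x, A x -> (f x <= D)%N.
Proof.
move=> /finite_seqP[s ->]; exists (\max_(x <- s) f x) => x /= xs.
by rewrite (big_rem x)//= leq_maxl.
Qed.

(** For h in H and k in K close to x, the pair a = x^-1 h, b = x^-1 k lies in a finite set. Fix for
    each such pair one c with c a in H and c b in K. Then x c^-1 = h (c a)^-1 = k (c b)^-1 lies in
    both subgroups, at bounded distance from x. *)
Lemma near_set_inter H K D : is_subgroup H -> is_subgroup K ->
  exists D', forall x, near_set H D x -> near_set K D x -> near_set (H `&` K) D' x.
Proof.
move=> [H1 HM HV] [K1 KM KV].
pose c (ab : G * G) := xget 1%g [set x | H (x * ab.1)%g /\ K (x * ab.2)%g].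
have fB := finite_setX (finite_ball S D) (finite_ball S D).
have [D' HD'] := finite_nat_bound (fun ab => wlen (c ab)^-1%g) fB.
exists D' => x [h Hh xh] [k Kk xk].
pose ab := ((x^-1 * h)%g, (x^-1 * k)%g).
have [Hc Kc] : H (c ab * ab.1)%g /\ K (c ab * ab.2)%g.
  rewrite /c; case: xgetP => [y -> //|/(_ x)] []; by rewrite /= !mulVKg.
exists (x * (c ab)^-1)%g; last by rewrite wdM; apply: HD'; split.
split.
  by have := HM _ _ Hh (HV _ Hc); rewrite invgM /= invgM invgK !mulgA mulgV mul1g.
by have := KM _ _ Kk (KV _ Kc); rewrite invgM /= invgM invgK !mulgA mulgV mul1g.
Qed.

End DiscreteStability.

(** * Corners of two stable subgroups *)

Section Corners.
Context {G : groupType} (S : generating_set G).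
Local Notation wd := (wd S).
Local Notation wlen := (wlen S).
Local Notation geo := (geo S).
Local Notation qg := (qg S).
Local Notation dstable := (dstable S).
Local Notation hausdorff_close := (hausdorff_close S).
Local Notation near_set := (near_set S).
Implicit Types (q u v : nat -> G) (k N i j D L : nat) (H K A I : set G).

(** The gauge has a single argument because [qg] has a single constant. *)
Definition dmorse (m : nat -> nat) N v : Prop :=
  forall k a b N' q, (a <= b <= N)%N -> qg k N' q -> q 0%N = v a -> q N' = v b ->
  hausdorff_close (m k) (b - a) (fun t => v (a + t)%N) N' q.

Definition dmqg k m N v : Prop := qg k N v /\ dmorse m N v.

Lemma dmqg_mono k k' m m' N v : (k <= k')%N -> (forall i, (m i <= m' i)%N) ->
  dmqg k m N v -> dmqg k' m' N v.
Proof.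
move=> kk mm [Q M]; split; first exact: qg_mono Q.
by move=> l a b N' q ab Ql qa qb; apply: hausdorff_close_le (mm l) _; exact: M.
Qed.

Lemma dmqg_sub k m N v a b : (a <= b <= N)%N -> dmqg k m N v ->
  dmqg k m (b - a) (fun t => v (a + t)%N).
Proof.
move=> ab [Q M]; split; first exact: qg_sub ab Q.
move=> l c d N' q cd Ql qc qd.
have /(_ Ql qc qd) := M l (a + c)%N (a + d)%N N' q ltac:(lia).
rewrite subnDl; set f := (fun t => _); set g := (fun t => _).
by have -> : f = g by apply/funext => t; rewrite /f /g addnA.
Qed.

Lemma dmqg_mul k m N v g : dmqg k m N v -> dmqg k m N (fun t => g * v t)%g.
Proof.
move=> [Q M]; split; first exact: qg_mul.
move=> l a b N' q ab Ql qa qb; apply/(hausdorff_close_mul _ _ g^-1).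
have /= := M l a b N' (fun t => g^-1 * q t)%g ab (qg_mul _ Ql).
rewrite qa qb !mulKg => /(_ erefl erefl); set f := (fun t => v _).
by have -> : f = (fun t => g^-1 * (g * v (a + t)%N))%g by apply/funext => t; rewrite mulKg.
Qed.

Lemma dmqg_eq k m N v v' : (forall t, (t <= N)%N -> v t = v' t) ->
  dmqg k m N v -> dmqg k m N v'.
Proof.
move=> e [Q M]; split; first exact: qg_eq e Q.
move=> l a b N' q ab Ql qa qb.
have [||F F'] := M l a b N' q ab Ql; rewrite ?e//; try lia.
split; first by move=> t tb; rewrite -e; [exact: F|lia].
by move=> t /F'[s sb ts]; exists s => //; rewrite -e//; lia.
Qed.

Lemma hausdorff_close_cat D N v a N' q r : (a <= N)%N -> (r <= N')%N ->
  hausdorff_close D a v r q ->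
  hausdorff_close D (N - a) (fun t => v (a + t)%N) (N' - r) (fun t => q (r + t)%N) ->
  hausdorff_close D N v N' q.
Proof.
move=> aN rN [F1 F1'] [F2 F2']; split=> i iN.
  have [ia|ai] := leqP i a.
    by have [j jr ij] := F1 i ia; exists j => //; lia.
  have [|j jr] := F2 (i - a)%N; first lia.
  have -> : (a + (i - a) = i)%N by lia.
  by move=> ij; exists (r + j)%N => //; lia.
have [ir|ri] := leqP i r.
  by have [j jr ij] := F1' i ir; exists j => //; lia.
have [|j jr] := F2' (i - r)%N; first lia.
have -> : (r + (i - r) = i)%N by lia.
by move=> ij; exists (a + j)%N => //; lia.
Qed.

(** Collects constants that depend on k into a gauge. *)
Lemma choice_nat (P : nat -> nat -> Prop) : (forall k, exists D, P k D) ->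
  exists f : nat -> nat, forall k, P k (f k).
Proof. by move=> /choice[f]; exists f. Qed.

Lemma near_geo H : is_subgroup H -> dstable H -> exists D, forall y i, H y ->
  (i <= wlen y)%N -> near_set H D (geo y i).
Proof.
move=> sH dH; have [D HD] := dH 1%N; exists D => y i Hy iy.
have [||+ _] := HD _ _ (@qg_geo _ S y); first by rewrite geo0; case: sH.
  by rewrite geo_end.
by apply.
Qed.

(** The cut is made at the point of q nearest to e. Each part, joined to e by a geodesic, is a
    quasigeodesic by [qg_nearest], which is applied to the reversed path for the first part. *)
Lemma qg_split_nearest k N q e : qg k N q -> exists2 r, (r <= N)%N &
  (exists N' p, [/\ qg (2 * k + 1) N' p, p 0%N = q 0%N, p N' = e &
     forall i, (i <= r)%N -> (i <= N')%N /\ p i = q i]) /\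
  (exists N' p, [/\ qg (2 * k + 1) N' p, p 0%N = e, p N' = q N &
     forall i, (r <= i <= N)%N -> exists2 t, (t <= N')%N & p t = q i]).
Proof.
move=> Q; have [r rN Hr] := nearest S e N q; exists r => //; split.
  have Hr' i : (i <= N)%N -> (wd e (q (N - (N - r))%N) <= wd e (q (N - i)%N))%N.
    by move=> iN; rewrite subKn//; apply: Hr; rewrite leq_subr.
  have := qg_nearest (qg_rev Q) (leq_subr r N) Hr'; rewrite subKn//.
  set l := wd e (q r); set A := concat _ _ _ => /qg_rev QA.
  have Aq i : (i <= r)%N -> A (l + (r - i))%N = q i.
    move=> ir; rewrite /A /concat; case: leqP => il; last by congr q; lia.
    by have -> : (l + (r - i) = l)%N by [lia]; rewrite geo_end mulVKg; congr q; lia.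
  exists (l + r)%N, (fun i => A (l + r - i)%N); split => //.
  - by rewrite subn0 -(Aq 0%N)// subn0.
  - by rewrite subnn /A /concat leq0n geo0 mulg1.
  - move=> i ir; split; first by lia.
    by rewrite -Aq//; congr A; lia.
have := qg_nearest Q rN Hr; set l := wd e (q r); set A := concat _ _ _ => QA.
have Aq i : (r <= i <= N)%N -> A (l + (i - r))%N = q i.
  move=> ri; rewrite /A /concat; case: leqP => il; last by congr q; lia.
  by have -> : (l + (i - r) = l)%N by [lia]; rewrite geo_end mulVKg; congr q; lia.
exists (l + (N - r))%N, A; split => //.
- by rewrite /A /concat leq0n geo0 mulg1.
- by apply: Aq; rewrite rN leqnn.
- by move=> i ri; exists (l + (i - r))%N; [lia|exact: Aq].
Qed.

(** Every point of such a geodesic is near H, so [dstable_hausdorff_close] applies to each of its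
    subsegments. The constant k + 1 serves both for the geodesic and for its competitor. *)
Lemma dmqg_geo H : is_subgroup H -> dstable H ->
  exists m, forall y, H y -> dmqg 1 m (wlen y) (geo y).
Proof.
move=> sH dH; have [D1 nH] := near_geo sH dH.
have [m Hm] := choice_nat (fun k => dstable_hausdorff_close (k + 1) D1 dH).
exists m => y Hy; split; first exact: qg_geo.
move=> k a b N q ab Q qa qb.
have cE x : near_set H D1 x -> near_set (lcoset_of 1%g H) D1 x.
  by move=> nx; apply/near_set_mulV; rewrite invg1 mul1g.
apply: (Hm k 1%g).
- by apply: qg_mono (qg_sub ab (@qg_geo _ S y)); rewrite leq_addl.
- by apply: qg_mono Q; rewrite leq_addr.
- by apply/cE/nH => //; lia.
- by apply/cE/nH => //; lia.
- by rewrite addn0 qa wdxx.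
- by rewrite subnKC ?qb ?wdxx//; lia.
Qed.

(** The path from 1 labelled by the word. It follows one geodesic per letter without
    reparametrization, so that corners occur at the partial sums of the lengths. *)
Fixpoint wpath (ys : seq G) : nat -> G :=
  if ys is y :: ys' then concat (wlen y) (geo y) (fun t => (y * wpath ys' t)%g)
  else fun=> 1%g.

Definition wtotal (ys : seq G) : nat := sumn (map wlen ys).

Lemma wtotal_cons y ys : wtotal (y :: ys) = (wlen y + wtotal ys)%N.
Proof. by []. Qed.

Lemma wpath0 ys : wpath ys 0%N = 1%g.
Proof. by case: ys => //= y ys; rewrite /concat /= geo0. Qed.

Lemma wpath_le y ys t : (t <= wlen y)%N -> wpath (y :: ys) t = geo y t.
Proof. by rewrite /= /concat => ->. Qed.

Lemma wpath_ge y ys t : wpath (y :: ys) (wlen y + t) = (y * wpath ys t)%g.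
Proof.
case: t => [|t]; first by rewrite addn0 wpath_le// geo_end wpath0 mulg1.
by rewrite /= /concat leqNgt addnS ltnS leq_addr /= subSn ?leq_addr// addKn.
Qed.

Lemma wpath_end ys : wpath ys (wtotal ys) = (\prod_(y <- ys) y)%g.
Proof.
elim: ys => [|y ys IH]; first by rewrite big_nil.
by rewrite wtotal_cons wpath_ge big_cons IH.
Qed.

Definition rminimal I (x : G) : Prop := forall z, I z -> (wlen x <= wlen (x * z)%g)%N.

(* If h is shortest in h(H ∩ K), then a quasigeodesic joining a point before to
   a point after the corner h of the path h, h * x passes near the corner: its
   nearest point to h is hausdorff_close to both H and hK, hence to h(H ∩ K). *)
Lemma corner_point H K k : is_subgroup H -> is_subgroup K -> dstable H -> dstable K ->
  exists D, forall h x, H h -> K x -> rminimal (H `&` K) h ->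
  forall N q a b, (a <= wlen h)%N -> (b <= wlen x)%N -> qg k N q ->
    q 0%N = geo h a -> q N = (h * geo x b)%g ->
    exists2 r, (r <= N)%N & (wd h (q r) <= D)%N.
Proof.
move=> sH sK dH dK.
have [DH nH] := near_geo sH dH; have [DK nK] := near_geo sK dK.
have [EH HEH] := dstable_fellow (2 * k + 1) DH dH.
have [EK HEK] := dstable_fellow (2 * k + 1) DK dK.
have [D' HD'] := near_set_inter S (EH + EK) sH sK.
exists (2 * EH + D')%N => h x Hh Kx mh N q a b ah bx Q q0 qN.
have [r rN [[N1 [p1 [Q1 p10 p1N p1q]]] [N2 [p2 [Q2 p20 p2N p2q]]]]] :=
  qg_split_nearest h Q.
exists r => //; have [rN1 p1r] := p1q r (leqnn r).
have hH : lcoset_of h H = H.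
  case: sH => _ HM HV; apply/seteqP; split=> [_ [z Hz <-]|z Hz]; first exact: HM.
  by exists (h^-1 * z)%g; [apply: HM => //; exact: HV|rewrite mulVKg].
have nrK : near_set (lcoset_of h K) EK (q r).
  have [||near_p2 _] := HEK h _ _ Q2.
  - by rewrite p20; apply/near_set_mem/lcoset_of_refl.
  - by rewrite p2N qN; apply/near_set_mul/nK.
  - have [|t tN2 <-] := p2q r; first by rewrite leqnn.
    exact: near_p2.
have [||near_p1 fp1] := HEH h _ _ Q1.
- by rewrite hH p10 q0; exact: nH.
- by rewrite p1N; apply/near_set_mem/lcoset_of_refl.
(* The nearest point to the corner lies on both halves of the cut path, hence near H as well as near
   hK. *)
have nrH : near_set H EH (q r) by rewrite -hH -p1r; exact: near_p1.
have [s [sh qs]] : exists s, (s <= wlen h)%N /\ (wd (q r) (geo h s) <= EH)%N.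
  have ah' : (a <= wlen h <= wlen h)%N by rewrite ah leqnn.
  have k1 : (1 <= 2 * k + 1)%N by rewrite addn1.
  have [|||j jh d] := fp1 _ _ (qg_mono k1 (qg_sub ah' (@qg_geo _ S h))) _ _ r.
  - by rewrite addn0 p10 q0 wdxx.
  - by rewrite subnKC// geo_end p1N wdxx.
  - exact: rN1.
  by rewrite p1r in d; exists (a + j)%N; split => //; lia.
have [y Iy qy] : near_set (lcoset_of h (H `&` K)) D' (q r).
  apply/near_set_mulV; apply: HD'.
    by apply/near_set_mulV; rewrite hH; apply: near_set_le nrH; lia.
  by apply/near_set_mulV; apply: near_set_le nrK; lia.
case: Iy qy => i Ii <- qy.
(* Minimality gives |h| <= |h i| <= s + EH + D'. Thus |h| - s is at most EH + D', and [q r], which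
   is within EH of the point s of the geodesic, is within 2 EH + D' of h. *)
have := mh i Ii; rewrite -(wd1 S (h * i)%g).
have := wd_tri S (q r) 1%g (h * i)%g; have := wd_tri S (geo h s) 1%g (q r).
have := wd_tri S (geo h s) h (q r).
rewrite (wdC S (geo h s)).
have := @geo_wd _ S h s (wlen h) ltac:(lia); rewrite geo_end (wdC S _ h).
have := @geo_wd _ S h 0 s ltac:(lia); rewrite geo0.
lia.
Qed.

(** By [corner_point], geodesics and quasigeodesics across the corner pass near it. The former makes
    the path a quasigeodesic. By the latter a competitor can be cut near the corner, and its two
    parts are compared with the geodesics in H and in hK. *)
Lemma dmqg_corner H K : is_subgroup H -> is_subgroup K -> dstable H -> dstable K ->
  exists k m, forall h x, H h -> K x -> rminimal (H `&` K) h ->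
  dmqg k m (wtotal [:: h; x]) (wpath [:: h; x]).
Proof.
move=> sH sK dH dK.
have [D0 HD0] := corner_point 1 sH sK dH dK.
have [E HE] := choice_nat (fun k => corner_point k sH sK dH dK).
have [mH HmH] := dmqg_geo sH dH; have [mK HmK] := dmqg_geo sK dK.
have near_translate A : is_subgroup A -> dstable A -> exists D, forall g y i, A y ->
    (i <= wlen y)%N -> near_set (lcoset_of g A) D (g * geo y i)%g.
  by move=> sA /(near_geo sA)[D HD]; exists D => g y i Ay iy; apply/near_set_mul/HD.
have [DH nH] := near_translate _ sH dH; have [DK nK] := near_translate _ sK dK.
have [CH HCH] := choice_nat (fun k => dstable_hausdorff_close (k + 1) (DH + E k) dH).
have [CK HCK] := choice_nat (fun k => dstable_hausdorff_close (k + 1) (DK + E k) dK).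
pose m k := (mH k + mK k + CH k + CK k)%N.
exists (2 * D0 + 1)%N, m => h x Hh Kx mh.
set v := wpath _; have -> : wtotal [:: h; x] = (wlen h + wlen x)%N by rewrite /wtotal /= addn0.
have vl t : (t <= wlen h)%N -> v t = geo h t by exact: wpath_le.
have vr t : (t <= wlen x)%N -> v (wlen h + t)%N = (h * geo x t)%g.
  by move=> tx; rewrite /v wpath_ge wpath_le.
have [Qh Mh] := HmH h Hh; have [Qx Mx] := dmqg_mul h (HmK x Kx).
split.
  move=> i j /andP[ij jN].
  have [jh|hj] := leqP j (wlen h).
    have [h1 h2] : _ /\ _ := Qh i j (introT andP (conj ij jh)).
    by rewrite !vl//; [split; nia|lia].
  have [ih|hi] := leqP i (wlen h); last first.
    have [h1 h2] : _ /\ _ := Qx (i - wlen h)%N (j - wlen h)%N ltac:(lia).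
    rewrite -(subnKC (ltnW hi)) -(subnKC (ltnW hj)) !vr; [|lia|lia].
    have e : (j - wlen h - (i - wlen h) = j - i)%N by lia.
    by rewrite e /= in h1 h2; split; nia.
  have jE : j = (wlen h + (j - wlen h))%N by lia.
  have jx : (j - wlen h <= wlen x)%N by lia.
  rewrite jE vl// vr//; set j' := (j - wlen h)%N in jx *.
  set p := geo h i; set z := (h * geo x j')%g; set d := wd p z.
  have Qg := qg_mul p (@qg_geo _ S (p^-1 * z)%g).
  have gd a b : (a <= b <= d)%N ->
      wd (p * geo (p^-1 * z) a) (p * geo (p^-1 * z) b)%g = (b - a)%N.
    by move=> ab; rewrite wd_mul geo_wd.
  (* A geodesic from p to z passes within D0 of h, so the way through the corner is at most 2 D0
     longer than [wd p z]. *)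
  have [||r rd hr] := HD0 h x Hh Kx mh _ _ i j' ih jx Qg.
  - by rewrite geo0 mulg1.
  - by rewrite geo_end mulVKg.
  have e1 := gd 0%N r ltac:(exact: rd); rewrite geo0 mulg1 in e1.
  have e2 : wd (p * geo (p^-1 * z) r)%g z = (d - r)%N.
    have zd : (p * geo (p^-1 * z) d)%g = z.
      by rewrite (_ : geo _ d = p^-1 * z)%g ?mulVKg//; exact: geo_end.
    by rewrite -{2}zd gd// leqnn andbT.
  have e3 : wd p h = (wlen h - i)%N by rewrite -{1}(geo_end S h) geo_wd// ih leqnn.
  have e4 : wd h z = j'.
    by rewrite /z -{1}(mulg1 h) wd_mul -(geo0 S x) geo_wd ?subn0//= leq0n.
  have t1 := wd_tri S (p * geo (p^-1 * z) r)%g p h.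
  have t2 := wd_tri S (p * geo (p^-1 * z) r)%g h z.
  have t3 := wd_tri S h p z; rewrite (wdC S (p * _)%g h) in t1.
  rewrite -/d in t3 *; move: hr; set y := (p * _)%g in e1 e2 t1 t2 * => hr.
  have -> : (wlen h + j' - i = (wlen h - i) + j')%N by lia.
  have rd' : (r <= d)%N := rd.
  have l1 : (wlen h - i + j' <= d + 2 * D0)%N by lia.
  split; last by nia.
   have : (d <= wlen h - i + j')%N by lia.
  nia.
move=> k a b N' q /andP[ab bN] Q qa qb.
have [bh|hb] := leqP b (wlen h).
  have [|||F F'] := Mh k a b N' q _ Q; rewrite ?ab ?bh// -?vl//; first exact: leq_trans bh.
  apply: (@hausdorff_close_le _ _ (mH k)); first by rewrite /m; lia.
  split=> [t tb|t /F'[s sb]]; first by rewrite vl; [exact: F|lia].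
  by rewrite -vl => [ts|]; [exists s|lia].
have [ha|ah] := leqP (wlen h) a.
  have ha' t : (t <= b - a)%N -> v (a + t)%N = (h * geo x (a - wlen h + t))%g.
    by move=> tb; rewrite -vr; [congr v|]; lia.
  have [|||F F'] := Mx k (a - wlen h)%N (b - wlen h)%N N' q _ Q.
  - lia.
  - by rewrite qa -vr; [congr v|]; lia.
  - by rewrite qb -vr; [congr v|]; lia.
  have -> : (b - a = b - wlen h - (a - wlen h))%N by lia.
  apply: (@hausdorff_close_le _ _ (mK k)); first by rewrite /m; lia.
  split=> [t tb|t /F'[s sb]]; first by rewrite ha'; [exact: F|lia].
  by rewrite -ha' => [ts|]; [exists s|lia].
have bx : (b - wlen h <= wlen x)%N by lia.
have bE : v b = (h * geo x (b - wlen h))%g by rewrite -vr//; congr v; lia.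
(* The remaining case is a subpath containing the corner in its interior; q is cut at a point r
   within [E k] of h. *)
have [||r rN hr] := HE k h x Hh Kx mh N' q a (b - wlen h)%N (ltnW ah) bx Q.
- by rewrite qa vl// ltnW.
- by rewrite qb.
apply: (@hausdorff_close_cat _ _ _ (wlen h - a) _ _ r) => //; first lia.
  apply: (@hausdorff_close_le _ _ (CH k)); first by rewrite /m; lia.
  have ah' : (a <= wlen h <= wlen h)%N by rewrite leqnn ltnW.
  have nH1 t : (t <= wlen h)%N -> near_set (lcoset_of 1%g H) (DH + E k) (geo h t).
    by move=> th; rewrite -(mul1g (geo h t)); apply: near_set_le (nH _ _ _ Hh th); lia.
  apply: (HCH k 1%g).
  - apply: (@qg_eq _ _ _ _ (fun t => geo h (a + t)%N)); first by move=> t ta; rewrite vl//; lia.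
    by apply: qg_mono (qg_sub ah' (@qg_geo _ S h)); lia.
  - have := qg_sub (_ : 0 <= r <= N')%N Q; rewrite subn0 => /(_ rN).
    by apply: qg_mono; lia.
  - by rewrite addn0 vl; [apply: nH1|]; lia.
  - by rewrite subnKC ?(ltnW ah)// vl//; apply: nH1.
  - by rewrite addn0 qa wdxx.
  - by rewrite subnKC ?(ltnW ah)// vl// geo_end; lia.
have -> : (b - a - (wlen h - a) = b - wlen h)%N by lia.
apply: (@hausdorff_close_le _ _ (CK k)); first by rewrite /m; lia.
have vE t : v (a + (wlen h - a + t))%N = v (wlen h + t)%N by congr v; lia.
apply: (HCK k h).
- apply: (@qg_eq _ _ _ _ (fun t => h * geo x t)%g).
    by move=> t ta; rewrite vE vr//; lia.
  apply: qg_mul; have := qg_sub (_ : 0 <= b - wlen h <= wlen x)%N (@qg_geo _ S x).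
  by rewrite subn0 => /(_ bx); apply: qg_mono; lia.
- by apply: qg_mono (qg_sub (_ : r <= N' <= N')%N Q); [lia|rewrite rN leqnn].
- by rewrite vE vr//; apply: near_set_le (nK h _ _ Kx _) => //; lia.
- by rewrite vE vr//; apply: near_set_le (nK h _ _ Kx _) => //; lia.
- by rewrite vE vr// geo0 mulg1 addn0; lia.
- by rewrite vE (subnKC (ltnW hb)) (subnKC rN) qb wdxx.
Qed.

End Corners.

(** * Alternating words *)

Section AlternatingWords.
Context {G : groupType}.
Implicit Types (T : bool -> set G) (P : G -> Prop) (xs ys : seq G) (I X : set G).
Local Open Scope group_scope.

Fixpoint alternating T (b : bool) xs : Prop :=
  if xs is x :: xs' then T b x /\ alternating T (~~ b) xs' else True.

Fixpoint all_but_last P xs : Prop :=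
  if xs is x :: xs' then (xs' <> [::] -> P x) /\ all_but_last P xs' else True.

(** The first and the last letter are exempt: only an interior letter separates two corners of the
    path. *)
Definition interior_letters P xs : Prop := all_but_last P (behead xs).

Lemma alternating_cat T b xs ys : alternating T b (xs ++ ys) <->
  alternating T b xs /\ alternating T (b (+) odd (size xs)) ys.
Proof.
elim: xs b => [|x xs IH] b /=; first by rewrite addbF; split=> [|[]].
rewrite IH addbN -addNb; split=> [[? [? ?]]|[[? ?] ?]]; by split.
Qed.

Lemma all_but_last_cat P xs y ys : all_but_last P (xs ++ y :: ys) <->
  (forall x, x \in xs -> P x) /\ all_but_last P (y :: ys).
Proof.
elim: xs => [|x xs IH]; first by split=> [|[]].
rewrite [(x :: xs) ++ _]/= [X in X <-> _]/= IH; split.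
  move=> [Px [Pxs Py]]; split => // z; rewrite inE => /orP[/eqP ->|/Pxs//].
  by apply: Px; case: xs {IH Pxs}.
move=> [Pxs Py]; split; first by move=> _; apply: Pxs; rewrite inE eqxx.
by split => // z zs; apply: Pxs; rewrite inE zs orbT.
Qed.

Lemma all_but_last_all P xs : (forall x, x \in xs -> P x) -> all_but_last P xs.
Proof.
elim: xs => //= x xs IH Pxs; split; first by move=> _; apply: Pxs; rewrite inE eqxx.
by apply: IH => y ys; apply: Pxs; rewrite inE ys orbT.
Qed.

Lemma all_but_lastN P xs : ~ all_but_last P xs ->
  exists ys x z zs, xs = ys ++ [:: x, z & zs] /\ ~ P x.
Proof.
elim: xs => [[]//|x xs IH] /= nP.
have [Px|] := pselect (xs <> [::] -> P x); last first.
  move=> /not_implyP[xs0 nPx].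
  by case: xs {IH nP} xs0 => // z zs _; exists [::], x, z, zs.
have [|ys [y [z [zs [-> nPy]]]]] := IH; first by move=> ?; apply: nP; split.
by exists (x :: ys), y, z, zs.
Qed.

Lemma all_but_last_behead P xs : all_but_last P xs -> interior_letters P xs.
Proof. by case: xs => //= x xs []. Qed.

Lemma all_but_last_imp P (Q : G -> Prop) xs : (forall x, P x -> Q x) ->
  all_but_last P xs -> all_but_last Q xs.
Proof. by move=> PQ; elim: xs => //= x xs IH [Px /IH Qxs]; split => // /Px/PQ. Qed.

(** An interior letter i of the intersection is merged with its neighbours x and y. As x and y
    belong to the same factor, so does x i y; the word stays alternating and loses two letters. *)
Lemma alternating_reduce T X b xs : (forall c, is_subgroup (T c)) -> is_subgroup X ->
  alternating T b xs -> interior_letters X xs ->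
  interior_letters (fun x => ~ (T true `&` T false) x) xs \/
  exists ys, [/\ alternating T b ys, size xs = (size ys).+2 /\ (0 < size ys)%N,
    \prod_(y <- ys) y = \prod_(x <- xs) x, interior_letters X ys &
    (forall x, x \in xs -> X x) -> forall y, y \in ys -> X y].
Proof.
move=> sT sX aT iX; set nI := (X in interior_letters X xs \/ _).
have [|niI] := pselect (interior_letters nI xs); [by left|right].
case: xs aT iX niI => [|x0 xs]; first by move=> _ _; case.
move=> aT iX /all_but_lastN[A [i [y [C [xsE /contrapT Ii]]]]].
have [A' [x A'x]] : exists A' x, x0 :: A = rcons A' x.
  exists (belast x0 A), (last x0 A); exact: lastI.
have xsE' : x0 :: xs = A' ++ [:: x, i, y & C].
  by rewrite -cat_rcons -A'x /= -[xs]/(behead (x0 :: xs)) xsE.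
rewrite xsE' in aT iX *.
have XM u v : X u -> X v -> X (u * v) by case: sX => _ + _; apply.
exists (A' ++ [:: x * i * y & C]); split.
- move: aT; rewrite !alternating_cat /= !negbK => -[aA [Tx [Ti [Ty aC]]]].
  split => //; split => //.
  set c := b (+) _ in Tx Ti Ty *; have [_ TM _] := sT c.
  apply: (TM) => //; apply: (TM) => //.
  by case: Ii; case: (c).
- by rewrite !size_cat /= !addnS.
- by rewrite !big_cat !big_cons /= !mulgA.
- case: (A') iX {xsE' A'x aT} => [|a A''] /=.
    by move=> [_ [_]].
  move=> /all_but_last_cat[XA [Xx [Xi [Xy XC]]]]; apply/all_but_last_cat.
  split => //; split => // C0.
  by apply: (XM); [apply: (XM); [exact: Xx|exact: Xi]|exact: Xy].
- move=> HX z; rewrite mem_cat inE => /orP[zA|/orP[/eqP ->|zC]].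
  + by apply: HX; rewrite mem_cat zA.
  + by apply: (XM); [apply: (XM)|]; apply: HX; rewrite mem_cat !inE eqxx ?orbT.
  + by apply: HX; rewrite mem_cat !inE zC !orbT.
Qed.

Definition biinvariant I P : Prop :=
  forall i x, I i -> P x -> P (i * x) /\ P (x * i).

Lemma biinvariant_subgroup I X : is_subgroup X -> I `<=` X -> biinvariant I X.
Proof. by move=> [_ XM _] IX i x /IX Xi Xx; split; exact: XM. Qed.

Lemma biinvariant_setN I X : is_subgroup I -> biinvariant I X ->
  biinvariant I (fun x => ~ X x).
Proof.
move=> [_ _ IV] bX i x Ii nXx; split=> Xx; apply: nXx.
  by have [+ _] := bX _ _ (IV _ Ii) Xx; rewrite mulKg.
by have [_] := bX _ _ (IV _ Ii) Xx; rewrite mulgK.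
Qed.

(** Each letter is paired with a letter 1 from the other factor, and the word ends with 1, k. Since
    k may lie outside X, the last letter is treated separately. *)
Lemma pad_word (H K X : set G) xs k : is_subgroup H -> is_subgroup K -> is_subgroup X ->
  (forall x, x \in xs -> ((H `|` K) `&` X) x) -> K k ->
  exists ys, [/\ alternating (fun b => if b then H else K) true ys,
    ~~ odd (size ys) /\ ys <> [::], \prod_(y <- ys) y = \prod_(x <- xs) x * k,
    all_but_last X ys & X k -> forall y, y \in ys -> X y].
Proof.
move=> [H1 _ _] [K1 _ _] [X1 _ _].
elim: xs => [|x xs IH] HX Kk.
  exists [:: 1; k]; split => //=.
  - by rewrite big_nil !big_cons big_nil mulg1.
  - by move=> Xk y; rewrite !inE => /orP[] /eqP ->.
have [|//|ys [aT [oys ys0] pE lX allX]] := IH.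
  by move=> y yxs; apply: HX; rewrite inE yxs orbT.
have [[Hx|Kx] Xx] : ((H `|` K) `&` X) x by apply: HX; rewrite inE eqxx.
- exists [:: x, 1 & ys]; split => //=; first by rewrite negbK oys.
  + by rewrite !big_cons pE mul1g mulgA.
  + by move=> /allX {}allX y; rewrite !inE => /or3P[/eqP ->|/eqP ->|/allX].
- exists [:: 1, x & ys]; split => //=; first by rewrite negbK oys.
  + by rewrite !big_cons pE mul1g mulgA.
  + by move=> /allX {}allX y; rewrite !inE => /or3P[/eqP ->|/eqP ->|/allX].
Qed.

(** The subgroup generated by A when A is closed under inverses. *)
Definition list_products (A : set G) : set G :=
  [set x | exists2 xs, (forall y, y \in xs -> A y) & \prod_(y <- xs) y = x].

Lemma list_products_mem (A : set G) x : A x -> list_products A x.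
Proof.
by move=> Ax; exists [:: x]; rewrite ?big_seq1// => y; rewrite inE => /eqP ->.
Qed.

Lemma list_products_subgroup (A : set G) : (forall x, A x -> A x^-1) ->
  is_subgroup (list_products A).
Proof.
move=> AV; split.
- by exists [::] => //; rewrite big_nil.
- move=> _ _ [xs Axs <-] [ys Ays <-]; exists (xs ++ ys); last by rewrite big_cat.
  by move=> y; rewrite mem_cat => /orP[/Axs|/Ays].
- move=> _ [xs Axs <-]; exists (rev [seq x^-1 | x <- xs]).
    by move=> y; rewrite mem_rev => /mapP[z /Axs/AV Az ->].
  elim: xs {Axs} => [|x xs IH]; first by rewrite !big_nil invg1.
  by rewrite /= rev_cons -cats1 big_cat IH !big_cons big_nil /= mulg1 invgM.
Qed.

Variable S : generating_set G.
Local Notation wlen := (wlen S).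

Lemma exists_rminimal I x : is_subgroup I -> exists2 i, I i & rminimal S I (x * i).
Proof.
move=> [I1 IM _].
pose P n := `[< exists2 i, I i & wlen (x * i) = n >].
have exP : exists n, P n by exists (wlen (x * 1)); apply/asboolP; exists 1.
have [n /asboolP[i Ii <-] Hmin] := find_ex_minn exP.
exists i => // j Ij; apply: Hmin; apply/asboolP; exists (i * j); first exact: IM.
by rewrite mulgA.
Qed.

(** From left to right, a letter x is replaced by a shortest element x i of x I, and i^-1 is moved
    into the next letter. The last letter only absorbs, so it need not be shortest. Letters change
    only by factors in I, which biinvariant properties do not notice. *)
Lemma normalise I xs : is_subgroup I ->
  exists ys, [/\ size ys = size xs, \prod_(y <- ys) y = \prod_(x <- xs) x,
    all_but_last (rminimal S I) ys,
    forall T b, (forall c, biinvariant I (T c)) -> alternating T b xs -> alternating T b ys &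
    forall P, biinvariant I P ->
      [/\ all_but_last P xs -> all_but_last P ys,
        interior_letters P xs -> interior_letters P ys &
        (forall x, x \in xs -> P x) -> forall y, y \in ys -> P y]].
Proof.
move=> sI; have [n] := ubnP (size xs); elim: n xs => // n IH [|x [|x' xs]] sxs.
- by exists [::].
- by exists [:: x]; split => //=; split => // [[]].
have [i Ii mi] := exists_rminimal x sI.
have IV : I i^-1 by case: sI => _ _; apply.
have [ys [sys pys mys aT iP]] := IH (i^-1 * x' :: xs) sxs.
exists (x * i :: ys); split.
- by rewrite /= sys.
- by rewrite big_cons pys !big_cons -!mulgA mulVKg.
- by split.
- move=> T b bT /= [Tx [Tx' Txs]]; split; first by case: (bT b _ _ Ii Tx).
  apply: aT => //; split => //.
  by case: (bT (~~ b) _ _ IV Tx').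
- move=> P bP; have [iP1 iP2 iP3] := iP P bP.
  have abl : all_but_last P (x' :: xs) -> all_but_last P (i^-1 * x' :: xs).
    move=> [Px' Pxs]; split => // /Px' {}Px'.
    by case: (bP _ _ IV Px').
  split.
  + move=> [Px Pxs]; split; last by apply/iP1/abl.
    by move=> _; have [] := bP _ _ Ii (Px _).
  + by move=> Pxs; apply/iP1/abl.
  + move=> allP y; rewrite inE => /orP[/eqP ->|].
      have Px : P x by apply: allP; rewrite inE eqxx.
      by case: (bP _ _ Ii Px).
    apply: iP3 => z; rewrite inE => /orP[/eqP ->|zxs].
      have Px' : P x' by apply: allP; rewrite !inE eqxx orbT.
      by case: (bP _ _ IV Px').
    by apply: allP; rewrite !inE zxs !orbT.
Qed.

End AlternatingWords.

(** * The combination theorem *)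

Section Combination.
Context {G : groupType} (S : generating_set G).
Local Notation wd := (wd S).
Local Notation wlen := (wlen S).
Local Notation geo := (geo S).
Local Notation qg := (qg S).
Local Notation dstable := (dstable S).
Local Notation hausdorff_close := (hausdorff_close S).
Local Notation near_set := (near_set S).
Local Notation dmqg := (dmqg S).
Local Notation wpath := (wpath S).
Local Notation wtotal := (wtotal S).
Implicit Types (q u v : nat -> G) (k N i j D L : nat) (H K A I X : set G).
Implicit Types (T : bool -> set G).

Lemma dstable_inter H K : is_subgroup H -> is_subgroup K -> dstable H -> dstable K ->
  dstable (H `&` K).
Proof.
move=> sH sK dH dK k; have [DH HDH] := dH k; have [DK HDK] := dK k.
have [D HD] := near_set_inter S (DH + DK) sH sK.
exists (D + DH)%N => N q Q [Hq0 Kq0] [HqN KqN].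
have [nH fH] := HDH N q Q Hq0 HqN; have [nK _] := HDK N q Q Kq0 KqN.
split=> [i iN|N' q' Q' e0 eN].
  apply: (@near_set_le _ _ _ D); first by rewrite leq_addr.
  apply: HD; first by apply: near_set_le (nH i iN); rewrite leq_addr.
  by apply: near_set_le (nK i iN); rewrite leq_addl.
by apply: fellow_le (fH _ _ Q' e0 eN); rewrite leq_addl.
Qed.

(** The conjugate is at Hausdorff distance at most |x| from the coset x H. *)
Lemma dstable_conj H x : dstable H -> dstable (conj_by x H).
Proof.
move=> dH k; have [D HD] := dstable_fellow k (wlen x) dH.
exists (D + wlen x)%N => N q Q [a Ha q0] [b Hb qN].
have cE y h : H h -> (x * h * x^-1)%g = y -> near_set (lcoset_of x H) (wlen x) y.
  by move=> Hh <-; exists (x * h)%g; [exists h|rewrite wdC wdM wlenV].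
have [||nq fq] := HD x N q Q; [exact: cE q0|exact: cE qN|].
split=> [i /nq[_ [h Hh <-] d]|N' q' Q' e0 eN].
  exists (x * h * x^-1)%g; first by exists h.
  by have := wd_tri S (x * h)%g (q i) (x * h * x^-1)%g; rewrite wdM wlenV; lia.
by apply: fellow_le (fq _ _ Q' _ _); rewrite ?leq_addr// ?e0 ?eN wdxx.
Qed.

Lemma dstable1 : dstable [set 1%g].
Proof.
move=> k; exists (k * k + k)%N => N q Q q0 qN.
have Nk : (N <= k)%N.
  by have [_] := Q 0%N N ltac:(lia); rewrite q0 qN wdxx; lia.
have d0 i : (i <= N)%N -> (wd (q i) 1%g <= k * k + k)%N.
  move=> iN; have [+ _] := Q 0%N i ltac:(lia); rewrite q0 wdC subn0.
  move=> h; apply: leq_trans h _; rewrite leq_add2r leq_mul2l; lia.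
split=> [i iN|N' q' Q' e0 eN i iN]; first by exists 1%g; [|exact: d0].
by exists 0%N => //; rewrite e0 q0; exact: d0.
Qed.

(** The local-to-global property for sequences of vertices, deduced in [mltg_dmltg] from the
    property of the Cayley graph. *)
Definition dmltg : Prop := forall k m, exists L k' m', forall N v,
  (forall a b, (a <= b <= N)%N -> (b - a <= L)%N ->
     dmqg k m (b - a) (fun t => v (a + t)%N)) ->
  dmqg k' m' N v.

(** When interior letters have length at least L, a subpath of length at most L passes at most one
    corner. It is thus part of a single geodesic or of a path with two letters, and both are
    uniformly Morse. The local-to-global property does the rest. *)
Lemma wpath_dmqg T : dmltg -> (forall c, is_subgroup (T c)) ->
  (forall c, dstable (T c)) ->
  exists L k m, forall b ys, alternating T b ys ->
    all_but_last (rminimal S (T true `&` T false)) ys ->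
    interior_letters (fun y => (L <= wlen y)%N) ys ->
    dmqg k m (wtotal ys) (wpath ys).
Proof.
move=> mltg sT dT.
have [kt [mt HT]] := dmqg_corner (sT true) (sT false) (dT true) (dT false).
have [kf [mf HF]] := dmqg_corner (sT false) (sT true) (dT false) (dT true).
rewrite setIC in HF; set I := T true `&` T false in HT HF *.
have [gt Hgt] := dmqg_geo (sT true) (dT true).
have [gf Hgf] := dmqg_geo (sT false) (dT false).
pose k := (1 + kt + kf)%N; pose m i := (mt i + mf i + gt i + gf i)%N.
have corner b x y : T b x -> T (~~ b) y -> rminimal S I x ->
    dmqg k m (wtotal [:: x; y]) (wpath [:: x; y]).
  case: b => Tx Ty mx; [apply: dmqg_mono (HT _ _ Tx Ty mx)|apply: dmqg_mono (HF _ _ Tx Ty mx)];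
    rewrite /k /m => *; lia.
have single b x : T b x -> dmqg k m (wlen x) (geo x).
  by case: b => Tx; [apply: dmqg_mono (Hgt _ Tx)|apply: dmqg_mono (Hgf _ Tx)];
    rewrite /k /m => *; lia.
have [L [k' [m' HL]]] := mltg k m; exists L, k', m' => b ys aT mys iL.
apply: HL; elim: ys b aT mys iL => [|y ys IH] b.
  move=> _ _ _ a c ac _; have -> : (c - a = 0)%N by move: ac; rewrite /wtotal /=; lia.
  have [T1 _ _] := sT true; have := single true 1%g T1; rewrite wlen1.
  by apply: dmqg_eq => t; rewrite leqn0 => /eqP ->; rewrite geo0.
move=> /= [Ty aT] [my mys] iL a c; rewrite wtotal_cons => /andP[ac cN] caL.
have [cy|yc] := leqP c (wlen y).
  apply: (@dmqg_eq _ _ _ _ _ (fun t => geo y (a + t)%N)).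
    by move=> t ta; rewrite -[RHS]/(wpath (y :: ys) _) wpath_le//; lia.
  by apply: dmqg_sub (single _ _ Ty); rewrite ac.
have [ya|ay] := leqP (wlen y) a.
  apply: (@dmqg_eq _ _ _ _ _ (fun t => y * wpath ys (a - wlen y + t)%N)%g).
    by move=> t ta; rewrite -wpath_ge; congr (wpath (y :: ys) _); lia.
  apply: dmqg_mul; have -> : (c - a = c - wlen y - (a - wlen y))%N by lia.
  apply: (IH (~~ b)) => //; [exact: all_but_last_behead|lia|lia].
case: ys {IH} aT my mys iL cN => [|z zs]; first by rewrite /wtotal /= addn0; lia.
move=> [Tz _] my _ iL cN.
(* Either z is the last letter, or it is interior and has length at least L >= c - a. *)
have cyz : (c <= wlen y + wlen z)%N.
  case: zs my iL cN => [|z' zs] _; first by rewrite !wtotal_cons addn0.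
  by move=> [zL _] _; have := zL ltac:(by []); lia.
have vE t : (t <= wlen y + wlen z)%N ->
    wpath [:: y; z] t = wpath [:: y, z & zs] t.
  move=> tyz; have [ty|yt] := leqP t (wlen y); first by rewrite !wpath_le.
  by rewrite -(subnKC (ltnW yt)) !wpath_ge !wpath_le//; lia.
apply: (@dmqg_eq _ _ _ _ _ (fun t => wpath [:: y; z] (a + t)%N)).
  by move=> t ta; rewrite vE//; lia.
apply: dmqg_sub; last by apply: (corner b) => //; exact: my.
by rewrite ac /wtotal /= addn0.
Qed.

(** For subgroups, this is the group generated by H ∩ X and K ∩ X. With X = IN it is the group E of
    the overview. *)
Definition amalgam H K X : set G := list_products ((H `|` K) `&` X).

Lemma amalgam_subgroup H K X : is_subgroup H -> is_subgroup K -> is_subgroup X ->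
  is_subgroup (amalgam H K X).
Proof.
move=> [_ _ HV] [_ _ KV] [_ _ XV]; apply: list_products_subgroup => x [[Hx|Kx] Xx].
  by split; [left; exact: HV|exact: XV].
by split; [right; exact: KV|exact: XV].
Qed.

(** Every element of E is spelled by an alternating word whose path is a uniformly Morse
    quasigeodesic. This path stays near E, since its corners lie in E and its sides are near cosets
    of H ∩ X or K ∩ X. Quasigeodesics between points of E are close to translates of such paths. *)
Lemma dstable_amalgam H K X L k m : is_subgroup H -> is_subgroup K ->
  is_subgroup X -> dstable H -> dstable K -> H `&` K `<=` X ->
  (forall b ys, alternating (fun b => if b then H else K) b ys ->
    all_but_last (rminimal S (H `&` K)) ys ->
    interior_letters (fun y => (L <= wlen y)%N) ys ->
    dmqg k m (wtotal ys) (wpath ys)) ->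
  (forall x, (H `|` K) x -> X x -> ~ (H `&` K) x -> (L <= wlen x)%N) ->
  (exists D, forall h, H h -> near_set (H `&` X) D h) ->
  (exists D, forall h, K h -> near_set (K `&` X) D h) ->
  dstable (amalgam H K X).
Proof.
move=> sH sK sX dH dK IX good long [DH0 HDH0] [DK0 HDK0].
set E := amalgam H K X; set I := H `&` K in good long IX *.
have sE : is_subgroup E := amalgam_subgroup sH sK sX.
pose T b := if b then H else K.
have sT c : is_subgroup (T c) by case: c.
have sI : is_subgroup I by exact: is_subgroupI.
have bT c : biinvariant I (T c).
  by apply: biinvariant_subgroup => //; case: c => x [].
(* Interior letters in I are merged until none is left; the length drops each time. *)
have reduced b xs : alternating T b xs -> (forall x, x \in xs -> X x) ->
    exists c ys, [/\ alternating T c ys, forall x, x \in ys -> X x,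
      interior_letters (fun x => ~ I x) ys & (\prod_(y <- ys) y = \prod_(x <- xs) x)%g].
  have [n] := ubnP (size xs); elim: n xs => // n IH xs sxs aT allX.
  have [iI|[ys [aT' [sz _] pE _ aX]]] :=
    alternating_reduce sT sX aT (all_but_last_behead (all_but_last_all allX)).
    by exists b, xs.
  have [|c [zs [aTz aXz iz pz]]] := IH ys _ aT' (aX allX); first by rewrite sz in sxs; lia.
  by exists c, zs; split => //; rewrite pz.
have word x : E x -> exists ys, [/\ (\prod_(y <- ys) y)%g = x,
    exists b, alternating T b ys, forall y, y \in ys -> X y &
    dmqg k m (wtotal ys) (wpath ys)].
  move=> [xs HX xE].
  have [K1 _ _] := sK; have [X1 _ _] := sX.
  have [ys [aT _ pE _ aX]] := pad_word sH sK sX HX K1.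
  have [b [zs [aTz aXz iz pz]]] := reduced _ _ aT (aX X1).
  have [ws [_ pw mw aTw iw]] := normalise S zs sI.
  have aTw' := aTw T b bT aTz.
  have [_ _ aXw] := iw X (biinvariant_subgroup sX IX).
  exists ws; split; [by rewrite pw pz pE mulg1|by exists b|exact: aXw|].
  apply: (good b) => //.
  (* Having length at least L is not biinvariant under I. The biinvariant property [P] is carried
     through [normalise] instead, and implies it afterwards. *)
  pose P y := (H `|` K) y /\ X y /\ ~ I y.
  apply: (@all_but_last_imp _ P); first by move=> y [? [? ?]]; exact: long.
  have bE : biinvariant I (H `|` K).
    move=> i x0 Ii [Hx|Kx]; first by case: (bT true _ _ Ii Hx); split; left.
    by case: (bT false _ _ Ii Kx); split; right.
  have bP : biinvariant I P.
    have bX := biinvariant_subgroup sX IX.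
    have bN := biinvariant_setN sI (biinvariant_subgroup sI (@subset_refl _ I)).
    move=> i x0 Ii [/(bE _ _ Ii)[? ?] [/(bX _ _ Ii)[? ?] /(bN _ _ Ii)[? ?]]].
    by split; split.
  have [_ + _] := iw P bP; apply.
  have allHK c ss : alternating T c ss -> forall y, y \in ss -> (H `|` K) y.
    elim: ss c => // s ss IH c [Ts /IH{}IH] y; rewrite inE => /orP[/eqP ->|/IH//].
    by case: c Ts; [left|right].
  have := allHK _ _ aTz; move: iz aXz; rewrite /interior_letters.
  case: (zs) => // z0 ss /= iz aXz hkz.
  elim: ss iz aXz hkz => //= s ss IH [nI iz] aXz hkz; split.
    by move=> ss0; split; [|split]; [apply: hkz|apply: aXz|exact: nI];
      rewrite !inE eqxx orbT.
  apply: IH => // y; rewrite inE => /orP yss; [apply: aXz|apply: hkz];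
    by rewrite !inE; case: yss => ->; rewrite ?orbT.
have [DH nH] := near_geo sH dH; have [DK nK] := near_geo sK dK.
pose D := (DH + DH0 + (DK + DK0))%N.
have subE A : A `<=` H `|` K -> A `&` X `<=` E.
  by move=> AHK x [/AHK HKx Xx]; apply: list_products_mem.
have near_path b ys : alternating T b ys -> (forall y, y \in ys -> X y) ->
    forall t, (t <= wtotal ys)%N -> near_set E D (wpath ys t).
  elim: ys b => [|y ys IH] b /= .
    by move=> _ _ t _; apply: near_set_mem; case: sE.
  move=> [Ty aT] aX t; rewrite wtotal_cons => tN.
  have [ty|yt] := leqP t (wlen y).
    rewrite -[concat _ _ _]/(wpath (y :: ys)) wpath_le//.
    case: b Ty {aT} => Ty.
      have [h Hh d] := nH _ _ Ty ty; have [h' Hh' d'] := HDH0 h Hh.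
      exists h'; first by apply: (subE H) => // ?; left.
      by have := wd_tri S h (geo y t) h'; rewrite /D; lia.
    have [h Hh d] := nK _ _ Ty ty; have [h' Hh' d'] := HDK0 h Hh.
    exists h'; first by apply: (subE K) => // ?; right.
    by have := wd_tri S h (geo y t) h'; rewrite /D; lia.
  rewrite -[concat _ _ _]/(wpath (y :: ys)) -(subnKC (ltnW yt)) wpath_ge.
  have [e Ee d] : near_set E D (wpath ys (t - wlen y)%N).
    by apply: (IH (~~ b)) => //; [move=> z zs; apply: aX; rewrite inE zs orbT|lia].
  exists (y * e)%g; last by rewrite wd_mul.
  case: sE => _ EM _; apply: (EM) => //; apply: list_products_mem; split.
    by case: (b) Ty; [left|right].
  by apply: aX; rewrite inE eqxx.
move=> l; exists (2 * m l + D)%N => N q Q Eq0 EqN.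
have [E1 EM EV] := sE.
have [ys [pE [b aT] aX [_ my]]] := word _ (EM _ _ (EV _ Eq0) EqN).
have my' : forall N' q', qg l N' q' -> q' 0%N = q 0%N -> q' N' = q N ->
    hausdorff_close (m l) (wtotal ys) (fun t => q 0%N * wpath ys t)%g N' q'.
  move=> N' q' Q' e0 eN; apply/(hausdorff_close_mul _ _ (q 0%N)^-1).
  have := my l 0%N (wtotal ys) N' (fun t => (q 0%N)^-1 * q' t)%g.
  rewrite leqnn subn0 e0 eN mulVg wpath0 wpath_end pE => /(_ isT (qg_mul _ Q') erefl erefl).
  set f := (fun t => wpath _ _); set g := (fun t => (_ * (_ * _))%g).
  by have -> : f = g by apply/funext => t; rewrite /g mulKg.
have [F F'] := my' _ _ Q erefl erefl.
split=> [i /F'[t tN d]|N' q' Q' e0 eN].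
  have [e Ee d'] := near_path _ _ aT aX t tN.
  exists (q 0%N * e)%g; first exact: EM.
  have := wd_tri S (q 0%N * wpath ys t)%g (q i) (q 0%N * e)%g.
  by rewrite wd_mul; lia.
have [F2 _] := my' _ _ Q' e0 eN.
by apply: fellow_le (fellow_trans F' F2); lia.
Qed.

End Combination.

(** * Polygons and products of cosets *)

Section Products.
Context {G : groupType} (S : generating_set G).
Local Notation wd := (wd S).
Local Notation wlen := (wlen S).
Local Notation qg := (qg S).
Local Notation dstable := (dstable S).
Local Notation near_set := (near_set S).
Local Notation ball := (ball S).
Local Notation wpath := (wpath S).
Local Notation wtotal := (wtotal S).
Implicit Types (q u v : nat -> G) (k N i j D L n : nat) (H K A I X Q P : set G).
Implicit Types (T : bool -> set G) (Hs : seq (set G)).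
Local Open Scope group_scope.

Definition dstable_subgroup H : Prop := is_subgroup H /\ dstable H.

(** A single translation on the right is enough: translations between the factors are absorbed by
    conjugating the factors, which preserves stability. *)
Definition coset_product n Q : Prop := exists Hs x,
  [/\ (size Hs <= n)%N, forall H, H \in Hs -> dstable_subgroup H &
      Q = rtrans (sprod Hs) x].

Lemma coset_product_mono n m Q : (n <= m)%N -> coset_product n Q -> coset_product m Q.
Proof.
by move=> nm [Hs [x [sHs HsP ->]]]; exists Hs, x; split => //; exact: leq_trans nm.
Qed.

Lemma coset_product_set1 x : coset_product 0 [set x].
Proof.
exists [::], x; split => //; apply/seteqP; split=> [_ ->|_ [_ -> <-]].
  by exists 1 => //; rewrite mul1g.
by rewrite mul1g.
Qed.

Lemma coset_product_rtrans n Q x : coset_product n Q -> coset_product n (rtrans Q x).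
Proof.
move=> [Hs [y [sHs HsP ->]]]; exists Hs, (y * x); split => //.
apply/seteqP; split=> [_ [_ [p Hp <-] <-]|_ [p Hp <-]].
  by exists p => //; rewrite mulgA.
by exists (p * y); [exists p|rewrite mulgA].
Qed.

(** One has p x h y = p (x h x^-1) (x y), so the new factor is the conjugate of H by x. *)
Lemma coset_product_mulr n Q H y : coset_product n Q -> dstable_subgroup H ->
  coset_product n.+1 [set p * h * y | p in Q & h in H].
Proof.
move=> [Hs [x [sHs HsP ->]]] [sH dH].
exists (rcons Hs (conj_by x H)), (x * y); split; first by rewrite size_rcons.
  move=> K; rewrite mem_rcons inE => /orP[/eqP ->|/HsP//].
  by split; [exact: is_subgroup_conj|exact: dstable_conj].
apply/seteqP; split.
  move=> _ [_ [p Hp <-] [h Hh <-]]; exists (p * (x * h * x^-1)).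
    by apply/sprod_rcons; exists p, (x * h * x^-1); split => //; exists h.
  by rewrite !mulgA mulgVK.
move=> _ [_ /sprod_rcons[p [_ [Hp [h Hh <-] ->]]] <-].
exists (p * x); first by exists p.
by exists h => //; rewrite !mulgA mulgVK.
Qed.

Lemma coset_product_mull n Q H : coset_product n Q -> dstable_subgroup H ->
  coset_product n.+1 [set h * p | h in H & p in Q].
Proof.
move=> [Hs [x [sHs HsP ->]]] sdH; exists (H :: Hs), x; split => //.
  by move=> K; rewrite inE => /orP[/eqP ->|/HsP].
apply/seteqP; split.
  move=> _ [h Hh [_ [p Hp <-] <-]]; exists (h * p); last by rewrite mulgA.
  by exists h => //; exists p.
move=> _ [_ [h Hh [p Hp <-]] <-]; exists h => //.
by exists (p * x); [exists p|rewrite mulgA].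
Qed.

Lemma near_cosetP H D z x : near_set (lcoset_of z H) D x ->
  exists h y, [/\ H h, ball D y & x = z * h * y].
Proof.
move=> [_ [h Hh <-] d]; exists h, ((z * h)^-1 * x); split => //; last by rewrite mulVKg.
by rewrite /ball /= -/(wd _ _) wdC.
Qed.

(* The sides of the polygon lie in z0 H_1, z1 H_2, ..., with z_(i-1)^-1 z_i in
   H_i.  Cutting the quasigeodesic at its nearest point to the last corner
   leaves a polygon with one side fewer, and a part which is close to the last
   coset. *)
Lemma polygon Hs k : (forall H, H \in Hs -> dstable_subgroup H) ->
  exists F : set (set G), [/\ finite_set F,
    forall Q, F Q -> coset_product (size Hs) Q &
    forall z0 z N q i j, sprod Hs (z0^-1 * z) -> qg k N q ->
      q 0%N = z0 -> q N = z -> (i <= j <= N)%N ->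
      exists2 Q, F Q & Q ((q i)^-1 * q j) /\
        forall x, Q x -> sprod Hs (z0^-1 * (q i * x * (q j)^-1 * z))].
Proof.
elim/last_ind: Hs k => [|Hs H IH] k HsP.
  exists [set [set x] | x in ball (k * k + k)]; split.
  - exact/finite_image/finite_ball.
  - by move=> _ [x _ <-]; exact: coset_product_set1.
  move=> z0 z N q i j /= zz Q q0 qN ij.
  (* Without factors z = z0, and a quasigeodesic with equal endpoints has bounded length. *)
  have Nk : (N <= k)%N.
    have [_] := Q 0%N N ltac:(lia); rewrite q0 qN subn0.
    by rewrite -[wd z0 z]/(wlen (z0^-1 * z)) zz wlen1; lia.
  exists [set (q i)^-1 * q j].
    exists ((q i)^-1 * q j) => //; rewrite /ball /= -/(wd _ _).
    have [+ _] := Q i j ij; move=> h; apply: leq_trans h _.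
    by rewrite leq_add2r leq_mul2l; lia.
  split=> // x ->; rewrite mulVKg mulgV mul1g; exact: zz.
have HsP' K : K \in Hs -> dstable_subgroup K.
  by move=> Ks; apply: HsP; rewrite mem_rcons inE Ks orbT.
have [sH dH] : dstable_subgroup H by apply: HsP; rewrite mem_rcons inE eqxx.
have [H1 HM HV] := sH.
have [F0 [fF0 pF0 HF0]] := IH (2 * k + 1)%N HsP'.
have [D HD] := dstable_fellow (2 * k + 1) 0 dH.
(* When i and j both lie before the cut, a set of [F0] serves. The sets [Q1] are for i and j both
   after the cut, the sets [Q2] for i before and j after it. *)
pose Q1 (y y' : G) := [set p * h * y' | p in [set y^-1] & h in H].
pose Q2 Q (y' : G) := [set p * h * y' | p in Q & h in H].
exists (F0 `|` [set Q1 y y' | y in ball D & y' in ball D] `|`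
  [set Q2 Q y' | Q in F0 & y' in ball D]); split.
- rewrite !finite_setU; split; first split => //; apply: finite_image2 => //;
    exact: finite_ball.
- rewrite size_rcons => Q [[/pF0|[y _ [y' _ <-]]]|[Q' /pF0 HQ' [y' _ <-]]].
  + exact: coset_product_mono.
  + apply: (@coset_product_mono 1); first by [].
    by apply: coset_product_mulr => //; exact: coset_product_set1.
  + exact: coset_product_mulr.
move=> z0 z N q i j /sprod_rcons[u [h0 [Hu Hh0 zE]]] Q q0 qN /andP[ij jN].
have [z1 [z1E zz1]] : exists z1, z0^-1 * z1 = u /\ z = z1 * h0.
  by exists (z0 * u); rewrite mulKg -mulgA -zE mulVKg.
have [r rN [[N1 [p1 [Qp1 p10 p1N p1q]]] [N2 [p2 [Qp2 p20 p2N p2q]]]]] :=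
  qg_split_nearest z1 Q.
have after a : (r <= a <= N)%N -> exists h y, [/\ H h, ball D y & q a = z1 * h * y].
  move=> /p2q[t tN <-]; apply: near_cosetP.
  have [||+ _] := HD z1 _ _ Qp2.
  - by rewrite p20; apply/near_set_mem/lcoset_of_refl.
  - by rewrite p2N qN; apply/near_set_mem; exists h0.
  - by apply.
have z01 : sprod Hs (z0^-1 * z1) by rewrite z1E.
rewrite -p10 in q0.
have [jr|rj] := leqP j r.
  have [jN1 p1j] := p1q j jr; have [iN1 p1i] := p1q i (leq_trans ij jr).
  have [Q' FQ' [Qij HQ']] := HF0 _ _ _ _ i j z01 Qp1 q0 p1N (introT andP (conj ij jN1)).
  exists Q'; first by left; left.
  rewrite -p1i -p1j; split => // x /HQ' sx; apply/sprod_rcons.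
  by exists (z0^-1 * (p1 i * x * (p1 j)^-1 * z1)), h0; split => //; rewrite zz1 !mulgA.
have [h' [y' [Hh' Dy' qj]]] := after j ltac:(lia).
have [ir|ri] := leqP i r.
  have [iN1 p1i] := p1q i ir.
  have [Q' FQ' [Qij HQ']] := HF0 _ _ _ _ i N1 z01 Qp1 q0 p1N (introT andP (conj iN1 (leqnn _))).
  exists (Q2 Q' y'); first by right; exists Q' => //; exists y'.
  rewrite p1i p1N in Qij HQ'; split.
    by exists ((q i)^-1 * z1) => //; exists h' => //; rewrite qj !mulgA.
  move=> _ [p Qp [h Hh <-]]; apply/sprod_rcons.
  exists (z0^-1 * (q i * p * z1^-1 * z1)), (h * h'^-1 * h0); split; first exact: HQ'.
    by apply: (HM) => //; apply: (HM) => //; exact: HV.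
  by rewrite qj zz1 !invgM !mulgA mulgVK !mulgK !mulgVK.
have [h [y [Hh Dy qi]]] := after i ltac:(lia).
exists (Q1 y y'); first by left; right; exists y => //; exists y'.
split.
  exists y^-1 => //; exists (h^-1 * h'); first by apply: (HM) => //; exact: HV.
  by rewrite qi qj !invgM !mulgA mulgVK.
move=> _ [_ -> [x Hx <-]]; apply/sprod_rcons.
exists u, (h * x * h'^-1 * h0); split => //.
  exact: (HM _ _ (HM _ _ (HM _ _ Hh Hx) (HV _ Hh')) Hh0).
by rewrite qi qj zz1 -z1E !invgM !mulgA !mulgK mulgVK.
Qed.

Lemma all_but_last_and (P1 P2 : G -> Prop) (xs : seq G) : all_but_last P1 xs ->
  all_but_last P2 xs -> all_but_last (fun x => P1 x /\ P2 x) xs.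
Proof.
elim: xs => //= x xs IH [h1 t1] [h2 t2]; split; last exact: IH.
by move=> xs0; split; [exact: h1|exact: h2].
Qed.

(** * Shortening an alternating word by means of the polygon *)

Section Step.
Variables (Hs : seq (set G)) (H K : set G) (g : G).
Hypothesis HsP : forall A, A \in Hs -> dstable_subgroup A.
Hypotheses (sH : is_subgroup H) (sK : is_subgroup K).
Hypotheses (dH : dstable H) (dK : dstable K).
Let I : set G := H `&` K.
Let T b := if b then H else K.
Let P := sprod Hs.
Variables (L k : nat) (m : nat -> nat).
Hypothesis good : forall b ys, alternating T b ys -> all_but_last (rminimal S I) ys ->
  interior_letters (fun y => (L <= wlen y)%N) ys ->
  dmqg S k m (wtotal ys) (wpath ys).
(** The constant which [qg_pad] yields when the end g of a path with constant k is joined to 1. *)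
Let k' := (k + 2 + 2 * wlen g * (k + 2) + 2 * wlen g)%N.
Variables (F : set (set G)) (X : set G).
Hypothesis polyF : forall z0 z N q i j, sprod (rev Hs) (z0^-1 * z) -> qg k' N q ->
  q 0%N = z0 -> q N = z -> (i <= j <= N)%N ->
  exists2 Q, F Q & Q ((q i)^-1 * q j) /\
    forall x, Q x -> sprod (rev Hs) (z0^-1 * (q i * x * (q j)^-1 * z)).
Hypothesis sX : is_subgroup X.
Hypothesis IX : I `<=` X.
Hypothesis XF : forall Q x, F Q -> Q x -> X x -> exists2 i, I i & Q i.
Hypothesis longX : forall x, X x -> ~ I x -> (L <= wlen x)%N.
Hypothesis gN : forall p h x, P p -> H h -> K x -> p * h * x <> g.

Let sT c : is_subgroup (T c). Proof. by case: c. Qed.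

Let sI : is_subgroup I. Proof. exact: is_subgroupI. Qed.

Let bT c : biinvariant I (T c).
Proof. by apply: biinvariant_subgroup => //; case: c => x []. Qed.

(** Strong induction on the length, for all p at once. An interior letter of I is merged; otherwise
    the second letter is exchanged for an element of I, at the expense of p, and then merged.
    Evenness excludes a single letter, and two letters contradict [gN]. *)
Lemma alternating_word_avoids xs p : P p -> alternating T true xs ->
  ~~ odd (size xs) -> xs <> [::] -> interior_letters X xs ->
  p * \prod_(x <- xs) x <> g.
Proof.
have [n] := ubnP (size xs); elim: n xs p => // n IH xs p sxs Pp aT oxs xs0 iX gE.
have [iI|[ys [aTy [sy sy0] pE iy _]]] := alternating_reduce sT sX aT iX; last first.
  apply: (IH ys p); rewrite ?pE//; [lia|by move: oxs; rewrite sy /= negbK|by case: (ys) sy0].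
have [ys [sys pys mys aTys iys]] := normalise S xs sI.
have [_ iysXI _] := iys (fun x => X x /\ ~ I x) ltac:(
  move=> i x Ii [Xx nIx];
  have [? ?] := biinvariant_subgroup sX IX Ii Xx;
  have [? ?] := biinvariant_setN sI (biinvariant_subgroup sI (@subset_refl _ I)) Ii nIx;
  by split; split).
have {iysXI}iysXI := iysXI (all_but_last_and iX iI).
have {aTys}aTys := aTys T true bT aT.
have iL : interior_letters (fun y => (L <= wlen y)%N) ys.
  by apply: all_but_last_imp iysXI => x [Xx nIx]; exact: longX.
have [Qys _] := good aTys mys iL.
rewrite -pys in gE; rewrite -sys in sxs oxs.
have ys0 : ys <> [::] by move=> ys0; move: sys; rewrite ys0; case: (xs) xs0.
case: ys {xs xs0 iX iI iys sys pys aT mys iL} ys0 sxs oxs aTys Qys gE iysXI => [//|y1 [//|y2 [|y3 ys]]] _.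
  move=> _ _ [Hy1 [Ky2 _]] _ gE _; apply: (gN Pp Hy1 Ky2).
  by rewrite -gE !big_cons big_nil mulg1 mulgA.
move=> sxs oxs [Ty1 [Ty2 [Ty3 aT]]] Qys gE [/(_ ltac:(by [])) [Xy2 _] iX].
set w := [:: y1, y2, y3 & ys] in Qys gE.
pose v t := p * wpath w t.
have v0 : v 0%N = p by rewrite /v wpath0 mulg1.
have vN : v (wtotal w) = g by rewrite /v wpath_end.
(* The padded path runs from p through g to 1. It closes the polygon, as p^-1 lies in the product of
   the factors in reverse order. *)
have Qq : qg k' (wtotal w).+2 (pad p (wtotal w) v 1).
  by apply: qg_pad; [exact: qg_mul|rewrite v0 wdxx|rewrite vN wdC wd1].
(* The side of y2 runs from index i to index j; padding shifts both by one. *)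
pose i := wlen y1; pose j := (wlen y1 + wlen y2)%N.
have jN : (j <= wtotal w)%N by rewrite /w !wtotal_cons /j; lia.
have vi : v i = p * y1 by rewrite /v wpath_le// geo_end.
have vj : v j = p * y1 * y2 by rewrite /v wpath_ge wpath_le// geo_end mulgA.
have Pp' : sprod (rev Hs) (p^-1 * 1).
  by rewrite mulg1; apply: sprod_rev => // A /HsP[].
have ij : (i.+1 <= j.+1 <= (wtotal w).+2)%N by rewrite /i /j in jN *; lia.
have [Q FQ [Qy2 HQ]] := polyF Pp' Qq erefl (pad_end _ _ _ _) ij.
have iN : (i <= wtotal w)%N by rewrite /i /j in jN *; lia.
rewrite !pad_in// vi vj in Qy2 HQ; rewrite mulKg in Qy2.
have [z Iz Qz] := XF FQ Qy2 Xy2.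
have [Hz Kz] := Iz; have [_ HM _] := sH; have [_ XM _] := sX.
have HsV A : A \in rev Hs -> is_subgroup A by rewrite mem_rev => /HsP[].
(* The new element of P is p y1 y2 z^-1 y1^-1. Multiplied by y1 z y3, it gives p y1 y2 y3. *)
have := sprod_rev HsV (HQ z Qz); rewrite revK => Pp1.
apply: (IH (y1 * z * y3 :: ys) _ _ Pp1).
- by move: sxs => /=; lia.
- by split => //; apply: (HM) => //; exact: (HM).
- by move: oxs => /=; rewrite !negbK.
- by [].
- by case: iX => _; apply: all_but_last_imp => x [].
- rewrite -gE /w !big_cons !invgM !invgK invg1 !mulgA mul1g.
  by rewrite mulgVK mulgVK mulgVK.
Qed.

End Step.

End Products.

(** * Induction on the number of factors *)

Section Main.
Context {G : groupType} (S : generating_set G).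
Local Notation wlen := (wlen S).
Local Notation dstable := (dstable S).
Local Notation near_set := (near_set S).
Local Notation ball := (ball S).
Local Notation dstable_subgroup := (dstable_subgroup S).
Local Notation coset_product := (coset_product S).
Implicit Types (H K A I N X Q P : set G) (Hs : seq (set G)).
Local Open Scope group_scope.

Lemma is_subgroup_mul_normal I N : is_subgroup I -> normal_fi N ->
  is_subgroup [set i * n | i in I & n in N].
Proof.
move=> [I1 IM IV] [[N1 NM NV] _ NJ]; split.
- by exists 1 => //; exists 1 => //; rewrite mulg1.
- move=> _ _ [i Ii [n Nn <-]] [j Ij [l Nl <-]].
  exists (i * j); first exact: IM.
  exists (j^-1 * n * j * l); first by apply: (NM) => //; exact: NJ.
  by rewrite !mulgA mulgK.
- move=> _ [i Ii [n Nn <-]]; exists i^-1; first exact: IV.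
  exists (i * n^-1 * i^-1); last by rewrite invgM !mulgA mulVg mul1g.
  by have := NJ n^-1 i^-1 (NV _ Nn); rewrite invgK.
Qed.

Lemma right_reps H N : is_subgroup H -> normal_fi N ->
  exists F, [/\ finite_set F, F `<=` H & forall h, H h -> exists2 f, F f & N (h * f)].
Proof.
move=> [_ _ HV] [sN fN _]; have [F [fF FH HF]] := finite_coset_reps H sN fN.
exists F; split => // h /HV/HF[f Ff Nf]; exists f => //.
by have [_ _ NV] := sN; have := NV _ Nf; rewrite invgM !invgK.
Qed.

(** A first subgroup N makes X = IN avoid the short elements outside I and the sets of F disjoint
    from I. Then E is stable and g lies in none of the finitely many sets P f E f'^-1, which cover
    PHK. These are separable by induction, and a second subgroup N' separates g from all of them. *)
Lemma separable_product_step Hs H K : dmltg S ->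
  (forall A, A \in Hs -> dstable_subgroup A) -> dstable_subgroup H ->
  dstable_subgroup K -> (forall Q, coset_product (size Hs).+1 Q -> separable Q) ->
  separable (sprod (rcons (rcons Hs H) K)).
Proof.
move=> mltg HsP [sH dH] [sK dK] IH; apply/separableP => g ng.
pose I := H `&` K; pose T b := if b then H else K; pose P := sprod Hs.
have gN p h x : P p -> H h -> K x -> p * h * x <> g.
  move=> Pp Hh Kx gE; apply: ng; apply/sprod_rcons; exists (p * h), x; split => //.
  by apply/sprod_rcons; exists p, h.
have sI : is_subgroup I by exact: is_subgroupI.
have dI : dstable_subgroup I by split => //; exact: dstable_inter.
have sT c : is_subgroup (T c) by case: c.
have dT c : dstable (T c) by case: c.
have [L [k [m good]]] := wpath_dmqg mltg sT dT.
pose k' := (k + 2 + 2 * wlen g * (k + 2) + 2 * wlen g)%N.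
have HsP' A : A \in rev Hs -> dstable_subgroup A by rewrite mem_rev; exact: HsP.
have [F [fF pF polyF]] := polygon k' HsP'; rewrite size_rev in pF.
pose IQ Q := [set i * x | i in I & x in Q].
(* The set IQ contains 1 exactly when Q meets I. A subgroup N that misses IQ makes IN miss Q,
   because n = i^-1 x for x = i n in Q. *)
pose A1 := [set IQ Q | Q in [set Q | F Q /\ forall i, I i -> ~ Q i]].
pose A2 := [set IQ [set x] | x in [set x | ball L x /\ ~ I x]].
have [|A|N [nN HN]] := @separable_common_nbhd _ (A1 `|` A2) 1.
- rewrite finite_setU; split.
    by apply: finite_image; apply: sub_finite_set fF => Q [].
  by apply: finite_image; apply: sub_finite_set (finite_ball S L) => x [].
- have [_ _ IV] := sI.
  move=> [[Q [FQ QI] <-]|[x [_ nIx] <-]]; split.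
  + by apply: IH; apply: coset_product_mull => //; exact: pF.
  + move=> [i Ii [x Qx /eqP]]; rewrite mulg_eq1 => /eqP ix.
    by apply: (QI x) => //; rewrite -(invgK x) -ix; exact: IV.
  + apply: IH; apply: coset_product_mull => //.
    by apply: coset_product_mono (coset_product_set1 S x).
  + move=> [i Ii [_ -> /eqP]]; rewrite mulg_eq1 => /eqP ix.
    by apply: nIx; rewrite -(invgK x) -ix; exact: IV.
have [_ IM IV] := sI; have [[N1 _ _] _ _] := nN.
pose X := [set i * n | i in I & n in N].
have sX : is_subgroup X := is_subgroup_mul_normal sI nN.
have IX : I `<=` X by move=> i Ii; exists i => //; exists 1 => //; rewrite mulg1.
have NX n : N n -> X n.
  by move=> Nn; case: sI => I1 _ _; exists 1 => //; exists n => //; rewrite mul1g.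
have XF Q x : F Q -> Q x -> X x -> exists2 i, I i & Q i.
  move=> FQ Qx [i Ii [n Nn nx]]; apply: contrapT => nQ.
  apply: (HN (IQ Q) n) => //.
    by left; exists Q => //; split => // j Ij Qj; apply: nQ; exists j.
  by exists i^-1; [exact: IV|exists x => //; rewrite mul1g -nx mulKg].
have longX x : X x -> ~ I x -> (L <= wlen x)%N.
  move=> [i Ii [n Nn nx]] nIx; rewrite leqNgt; apply/negP => xL.
  apply: (HN (IQ [set x]) n) => //; first by right; exists x => //; split => //; exact: ltnW.
  by exists i^-1; [exact: IV|exists x => //; rewrite mul1g -nx mulKg].
have [FH [fFH FHH HFH]] := right_reps sH nN; have [FK [fFK FKK HFK]] := right_reps sK nN.
have [_ HM HV] := sH; have [_ KM KV] := sK.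
have near_reps A F' : (forall x y, A x -> A y -> A (x * y)) -> F' `<=` A -> finite_set F' ->
    (forall h, A h -> exists2 f, F' f & N (h * f)) ->
    exists D, forall h, A h -> near_set (A `&` X) D h.
  move=> AM FA fF' HF'; have [D HD] := finite_nat_bound wlen fF'.
  exists D => h Ah; have [f Ff Nhf] := HF' h Ah; exists (h * f).
    by split; [apply: AM => //; exact: FA|exact: NX].
  by rewrite wdM; exact: HD.
pose E := amalgam H K X.
have sE : is_subgroup E := amalgam_subgroup sH sK sX.
have dE : dstable E.
  apply: (dstable_amalgam sH sK sX dH dK IX good).
  - by move=> x _ Xx nIx; exact: longX.
  - exact: near_reps HFH.
  - exact: near_reps HFK.
(* This is P f E f'^-1, a coset product with one factor fewer than the product under
   consideration. *)
pose R f f' := [set p * e * f'^-1 | p in rtrans P f & e in E].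
have [|A|N' [nN' HN']] := @separable_common_nbhd _ [set R f f' | f in FH & f' in FK] g.
- exact: finite_image2.
- move=> [f Ff [f' Ff' <-]]; split.
    apply: IH; apply: coset_product_mulr => //; apply: coset_product_rtrans.
    exists Hs, 1; split => //; apply/seteqP; split=> [p Pp|_ [p Pp <-]].
      by exists p => //; rewrite mulg1.
    by rewrite mulg1.
  move=> [_ [p Pp <-] [_ [xs Hxs <-] gE]].
  have Kf' : K f'^-1 by apply/KV/FKK.
  have [ws [aT [ows ws0] pws lX _]] := pad_word sH sK sX Hxs Kf'.
  have [X1 _ _] := sX; have [K1 _ _] := sK.
  (* The word [ws] starts in H, so a letter 1 of K is put between f and [ws]. The extreme letters f
     and f'^-1 may lie outside X. *)
  have := @alternating_word_avoids _ S Hs H K g HsP sH sK L k m good F X polyF sX IX XF longX gN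
    [:: f, 1 & ws] p Pp; apply => //=.
  + by split; [exact: FHH|split].
  + by rewrite negbK.
  + by rewrite !big_cons pws mul1g !mulgA.
exists N'; split => // n Nn /sprod_rcons[_ [x [/sprod_rcons[p [h [Pp Hh ->]]] Kx gE]]].
have [f Ff Nf] := HFH _ (HV _ Hh); have Hf := FHH _ Ff.
have [f' Ff' Nf'] := HFK _ Kx.
apply: (HN' (R f f') n _ Nn); first by exists f => //; exists f'.
rewrite gE; exists (p * f); first by exists p.
have [_ EM _] := sE.
(* One has p h x = (p f) (f^-1 h) (x f') f'^-1, where f^-1 h lies in H ∩ N and x f' in K ∩ N, so
   that the middle part is in E. *)
exists (f^-1 * h * (x * f')); last by rewrite !mulgA !mulgK.
apply: (EM); apply: list_products_mem.
  split; first by left; apply: (HM) => //; exact: HV.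
  by apply: NX; have [[_ _ NV] _ _] := nN; have := NV _ Nf; rewrite invgM invgK.
split; first by right; apply: (KM) => //; exact: FKK.
exact: NX.
Qed.

(** The last two factors are split off, and the sets needed in [separable_product_step] have one
    factor fewer. Without factors, the trivial subgroup is stable. *)
Theorem coset_products_separable : dmltg S ->
  (forall H, dstable_subgroup H -> separable H) ->
  forall n Q, coset_product n Q -> separable Q.
Proof.
move=> mltg sep; elim/ltn_ind => n IH _ [Hs [x [sHs HsP ->]]].
apply: separable_rtrans; case/lastP: Hs sHs HsP => [|Hs K] sHs HsP.
  by apply: sep; split; [split=> [//|y z -> ->|y ->]; rewrite ?mulg1 ?invg1|exact: dstable1].
case/lastP: Hs sHs HsP => [|Hs H] sHs HsP.
  have -> : sprod (rcons [::] K) = K.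
    apply/seteqP; split=> [_ [h Kh [_ -> <-]]|h Kh]; first by rewrite mulg1.
    by exists h => //; exists 1 => //; rewrite mulg1.
  by apply: sep; apply: HsP; rewrite mem_rcons inE eqxx.
apply: separable_product_step => // [A As|||Q HQ].
- by apply: HsP; rewrite mem_rcons inE mem_rcons inE As !orbT.
- by apply: HsP; rewrite mem_rcons inE mem_rcons inE eqxx !orbT.
- by apply: HsP; rewrite mem_rcons inE eqxx.
- by apply: IH HQ; move: sHs; rewrite !size_rcons.
Qed.

End Main.

(** * Distances and geodesics in the Cayley graph *)

Local Open Scope ring_scope.

Section CayleyGraph.
Context {R : realType} {G : groupType} (S : generating_set G).
Local Notation cay := (cayley R S).
Implicit Types (p q : cay) (f : G -> R) (s t : R).

Lemma segment_pointC (g h : G) t : segment_point g h t = segment_point h g (1 - t).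
Proof. by apply/funext => x; rewrite /segment_point; ring. Qed.

(** Expresses the interpolated value through the coordinates of the point, so that it does not
    depend on the edge used to describe the point. *)
Lemma segment_point_sum f (r : seq G) (g h : G) t : uniq r -> g \in r -> h \in r ->
  \sum_(x <- r) segment_point g h t x * f x = (1 - t) * f g + t * f h.
Proof.
move=> ur gr hr.
have E (k : G) c : k \in r -> \sum_(x <- r) c * (x == k)%:R * f x = c * f k.
  move=> kr; rewrite (bigD1_seq k)//= eqxx mulr1 big1 ?addr0// => x /negPf ->.
  by rewrite mulr0 mul0r.
under eq_bigr do rewrite /segment_point mulrDl.
by rewrite big_split /= !E.
Qed.

(* Applied to the distance to a vertex, this bounds [cay_dist] from below. *)
Lemma affine_extension f : exists F : cay -> R, forall p g h t,
  cay_coord p = segment_point g h t -> F p = (1 - t) * f g + t * f h.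
Proof.
have : forall p, exists y, forall g h t,
    cay_coord p = segment_point g h t -> y = (1 - t) * f g + t * f h.
  move=> p; have [g [h [_ [t _ pE]]]] := proj2_sig p.
  exists ((1 - t) * f g + t * f h) => g' h' t' pE'.
  pose r := undup [:: g; h; g'; h'].
  rewrite -(@segment_point_sum f r) ?undup_uniq ?mem_undup ?inE ?eqxx ?orbT//.
  rewrite -(@segment_point_sum f r) ?undup_uniq ?mem_undup ?inE ?eqxx ?orbT//.
  by rewrite -pE' /cay_coord -pE.
by move=> /choice[F HF]; exists F.
Qed.

(** Each piece of a polyline lies in one edge, on which F is affine with slope at most 1. *)
Lemma affine_extension_lip f (F : cay -> R) :
  (forall p g h t, cay_coord p = segment_point g h t -> F p = (1 - t) * f g + t * f h) ->
  (forall g h, simplex S g h -> `|f g - f h| <= 1) ->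
  forall p q, F q - F p <= cay_dist p q.
Proof.
move=> FE fL p q; apply: cay_dist_ge => l; elim=> {p q l} [p|p q r g h l gh gp gq _ IH].
  by rewrite subrr.
suff : F q - F p <= `|p g - q g| by lra.
case: gp gq => s _ pE [t _ qE].
rewrite (FE p _ _ _ (esym pE)) (FE q _ _ _ (esym qE)).
rewrite -pE -qE /segment_point !eqxx.
have [<-|ngh] := eqVneq g h; first by rewrite !mulr1; apply: le_trans (normr_ge0 _); lra.
rewrite !mulr1 !mulr0 !addr0.
have -> : (1 - t) * f g + t * f h - ((1 - s) * f g + s * f h) = (s - t) * (f g - f h) by ring.
rewrite (le_trans (ler_norm _))// normrM.
have -> : 1 - s - (1 - t) = - (s - t) by ring.
by rewrite normrN ler_piMr// fL.
Qed.

Lemma cay_dist_edge p q (g h : G) s t : simplex S g h -> 0 <= s <= 1 -> 0 <= t <= 1 ->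
  cay_coord p = segment_point g h s -> cay_coord q = segment_point g h t ->
  cay_dist p q <= `|s - t|.
Proof.
move=> gh s01 t01 pE qE.
have gp : closed_segment g h p by exists s => //; rewrite /= in_itv.
have gq : closed_segment g h q by exists t => //; rewrite /= in_itv.
apply: le_trans (cay_dist_le (polyline_cons gh gp gq (polyline_nil q))) _.
rewrite addr0 pE qE /segment_point eqxx.
have [_|_] := eqVneq g h; rewrite ?mulr1 ?mulr0.
  have -> : 1 - s + s - (1 - t + t) = 0 by ring.
  by rewrite normr0.
by have -> : 1 - s + 0 - (1 - t + 0) = t - s by [ring]; rewrite distrC.
Qed.

Lemma vertexE (g h : G) : cay_coord (vertex S g) = segment_point g h (0 : R).
Proof. by apply/funext => x; rewrite /= /segment_point; ring. Qed.

Lemma vertex_inj (g h : G) : vertex S g = vertex S h :> cay -> g = h.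
Proof.
move=> /(congr1 (fun p : cay => p g)); rewrite /= /segment_point eqxx subr0 !mul0r !addr0 !mul1r.
by case: eqVneq => // _ /eqP; rewrite oner_eq0.
Qed.

Lemma simplex_step (g h : G) : letter S (g^-1 * h)%g \/ g = h -> simplex S g h.
Proof.
by case=> [[]|]; [right; left|rewrite invgM invgK; right; right|left].
Qed.

Lemma simplex_wd (g h : G) : simplex S g h -> (wd S g h <= 1)%N.
Proof.
case=> [->|]; first by rewrite wdxx.
by case=> [Sgh|Shg]; [|rewrite wdC]; apply: wlen_letter; left.
Qed.

(** The lower bound comes from the affine extension of the word distance to g, the upper bound from
    the edges of a shortest word. *)
Lemma cay_dist_vertex (g h : G) : cay_dist (vertex S g : cay) (vertex S h) = (wd S g h)%:R.
Proof.
apply/eqP; rewrite eq_le; apply/andP; split; last first.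
  pose f x := (wd S g x)%:R : R.
  have [F HF] := affine_extension f.
  have := affine_extension_lip HF _ (vertex S g) (vertex S h).
  rewrite (HF _ _ _ _ (vertexE g g)) (HF _ _ _ _ (vertexE h h)) /f wdxx.
  have -> : (1 - 0) * (wd S g h)%:R + 0 * (wd S g h)%:R - ((1 - 0) * 0%:R + 0 * 0%:R)
    = (wd S g h)%:R :> R by ring.
  apply=> x y xy; have := simplex_wd xy => d.
  have d1 := wd_tri S x g y; have d2 := wd_tri S y g x; rewrite (wdC S y x) in d2.
  have [e1 e2] : (wd S g y <= wd S g x + 1)%N /\ (wd S g x <= wd S g y + 1)%N by lia.
  by move: e1 e2; rewrite -!(ler_nat R) !natrD ler_norml; lra.
have H i : cay_dist (vertex S g : cay) (vertex S (g * geo S (g^-1 * h) i)%g) <= i%:R.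
  elim: i => [|i IH]; first by rewrite geo0 mulg1 cay_distxx.
  apply: le_trans (cay_dist_triangle (vertex S (g * geo S (g^-1 * h) i)%g) _ _) _.
  rewrite -natr1 lerD//.
  set x := (g * geo S _ i)%g; set y := (g * _)%g.
  have xy : simplex S x y.
    apply: simplex_step; rewrite /x /y invgM -mulgA mulKg.
    by case: (geo_step S (g^-1 * h) i) => [|->]; [left|right].
  apply: le_trans (cay_dist_edge (s := 0) (t := 1) xy _ _ (vertexE x y) _) _.
  - by rewrite lexx ler01.
  - by rewrite lexx ler01.
  - by rewrite segment_pointC subrr; exact: vertexE.
  - by rewrite sub0r normrN1.
by have := H (wlen S (g^-1 * h)%g); rewrite geo_end mulVKg.
Qed.

(** The second clause makes rounding exact at vertices, so that discretization keeps endpoints which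
    are vertices. *)
Lemma near_vertex p : exists g, cay_dist p (vertex S g) <= 1 /\
  forall h, p = vertex S h -> g = h.
Proof.
have [[h ph]|nv] := pselect (exists h, p = vertex S h).
  exists h; split; first by rewrite ph cay_distxx.
  by move=> h'; rewrite ph => /vertex_inj.
have [g [h [gh [t]]]] := proj2_sig p; rewrite /= in_itv /= => t01 pE.
exists g; split; last by move=> k pk; case: nv; exists k.
have h01 : 0 <= (0 : R) <= 1 by rewrite lexx ler01.
apply: le_trans (cay_dist_edge gh t01 h01 (esym pE) (vertexE g h)) _.
by rewrite subr0 ger0_norm; case/andP: t01.
Qed.

Definition round_vertex p : G := projT1 (cid (near_vertex p)).

Lemma round_vertex_dist p : cay_dist p (vertex S (round_vertex p)) <= 1.
Proof. by rewrite /round_vertex; case: cid => g [] /=. Qed.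

Lemma round_vertexK (g : G) : round_vertex (vertex S g) = g.
Proof. by rewrite /round_vertex; case: cid => x [] /= _; apply. Qed.

(** The edges of a shortest word are traversed at unit speed. The resulting path is 1-Lipschitz, and
    since its ends are at distance n, the triangle inequality forces equality everywhere. *)
Lemma real_geodesic (g h : G) : exists gamma : R -> cay,
  [/\ geodesic `[0, (wd S g h)%:R] gamma, gamma 0 = vertex S g &
      gamma (wd S g h)%:R = vertex S h].
Proof.
set n := wd S g h; pose v i := (g * geo S (g^-1 * h) i)%g.
have v0 : v 0%N = g by rewrite /v geo0 mulg1.
have vn : v n = h by rewrite /v /n (_ : geo _ _ _ = g^-1 * h)%g ?mulVKg//; exact: geo_end.
have vS i : simplex S (v i) (v i.+1).
  apply: simplex_step; rewrite /v invgM -mulgA mulKg.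
  by case: (geo_step S (g^-1 * h) i) => [|->]; [left|right].
have vd i j : (i <= j <= n)%N -> wd S (v i) (v j) = (j - i)%N.
  by move=> ij; rewrite /v wd_mul geo_wd.
have : forall t, exists p : cay, 0 <= t ->
    cay_coord p = segment_point (v (Num.truncn t)) (v (Num.truncn t).+1) (t - (Num.truncn t)%:R).
  move=> t; have [t0|/negP t0] := boolP (0 <= t); last by exists (vertex S 1%g).
  have tP : exists x y, simplex S x y /\ closed_segment x y
      (segment_point (v (Num.truncn t)) (v (Num.truncn t).+1) (t - (Num.truncn t)%:R)).
    exists (v (Num.truncn t)), (v (Num.truncn t).+1); split => //.
    exists (t - (Num.truncn t)%:R) => //=; rewrite in_itv /=.
    by have := truncn_itv t0; rewrite -natr1; lra.
  by exists (exist (fun p : G -> R => exists x y, simplex S x y /\ closed_segment x y p) _ tP).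
move=> /choice[gamma Hg].
have gi i : gamma i%:R = vertex S (v i).
  apply: cayley_ext; rewrite (Hg i%:R)//; first by rewrite natrK subrr -vertexE.
have ge s : 0 <= s -> forall t, s <= t <= (Num.truncn s).+1%:R ->
    cay_dist (gamma s) (gamma t) <= t - s.
  move=> s0 t; set i := Num.truncn s => /andP[st ti].
  have si := truncn_itv s0; rewrite -/i in si.
  (* At t = i + 1 the truncation already belongs to the next edge, but the point is still the end of
     edge i. *)
  have gt : cay_coord (gamma t) = segment_point (v i) (v i.+1) (t - i%:R).
    have [->|ti'] := eqVneq t i.+1%:R.
      rewrite gi segment_pointC -natr1 addrAC subrr add0r subrr; exact: vertexE.
    have tE : Num.truncn t = i.
      apply: truncn_def; rewrite lt_neqAle ti' ti !andbT.
      by apply: le_trans st; case/andP: si.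
    by rewrite Hg ?tE// (le_trans s0).
  have {}si : i%:R <= s < i%:R + 1 by rewrite natr1.
  rewrite -natr1 in ti.
  apply: le_trans (cay_dist_edge (vS i) _ _ (Hg s s0) gt) _; rewrite -/i; [lra|lra|].
  by have -> : s - i%:R - (t - i%:R) = - (t - s) by [ring]; rewrite normrN ger0_norm; lra.
have lip s t : 0 <= s -> s <= t -> t <= n%:R -> cay_dist (gamma s) (gamma t) <= t - s.
  move=> s0 st tn; have t0 := le_trans s0 st.
  have [ts|st'] := leP t (Num.truncn s).+1%:R; first by apply: ge; rewrite ?st.
  set i := Num.truncn s in st' *; set j := Num.truncn t.
  have ij : (i.+1 <= j)%N by rewrite truncn_ge_nat// ltW.
  have jt := truncn_itv t0; rewrite -/j in jt.
  have jn : (j <= n)%N by rewrite -(ler_nat R) (le_trans _ tn)//; case/andP: jt.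
  have si := truncn_itv s0; rewrite -/i in si.
  have d1 : cay_dist (gamma s) (gamma i.+1%:R) <= i.+1%:R - s.
    by apply: ge => //; rewrite lexx andbT ltW//; case/andP: si.
  have d2 : cay_dist (gamma i.+1%:R) (gamma j%:R) = j%:R - i.+1%:R.
    by rewrite !gi cay_dist_vertex vd ?ij// natrB.
  have d3 : cay_dist (gamma j%:R) (gamma t) <= t - j%:R.
    by apply: ge; rewrite ?natrK//; lra.
  have := cay_dist_triangle (gamma i.+1%:R) (gamma s) (gamma t).
  have := cay_dist_triangle (gamma j%:R) (gamma i.+1%:R) (gamma t).
  lra.
exists gamma; split; last 2 first.
- by rewrite -[0]/(0%:R) gi v0.
- by rewrite gi vn.
split; first exact: interval_is_interval.
suff main s t : 0 <= s -> s <= t -> t <= n%:R -> cay_dist (gamma s) (gamma t) = t - s.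
  move=> s t; rewrite /= !in_itv /= => /andP[s0 sn] /andP[t0 tn].
  rewrite /mdist /=; have [st|/ltW ts] := leP s t.
    by rewrite -/(cay_dist _ _) main// distrC ger0_norm ?subr_ge0.
  by rewrite -/(cay_dist _ _) cay_dist_sym main// ger0_norm ?subr_ge0.
move=> s0 st tn; apply/eqP; rewrite eq_le lip//=.
have := lip 0 s (lexx _) s0 (le_trans st tn).
have := lip t n%:R (le_trans s0 st) tn (lexx _).
have := cay_dist_triangle (gamma s) (gamma 0) (gamma n%:R).
have := cay_dist_triangle (gamma t) (gamma s) (gamma n%:R).
rewrite -[0]/(0%:R) !gi v0 vn cay_dist_vertex -/n; lra.
Qed.

End CayleyGraph.

(** * From quasigeodesics to sequences of vertices and back *)

Section Hausdorff.
Context {R : realType} {X : metricType R}.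
Implicit Types (A B : set X) (r : R).

Lemma hausdorff_dist_le A B r : 0 <= r ->
  (forall x, A x -> exists2 y, B y & mdist x y <= r) ->
  (forall y, B y -> exists2 x, A x & mdist y x <= r) ->
  (hausdorff_dist A B <= r%:E)%E.
Proof. by move=> r0 AB BA; apply: ereal_inf_lbound; exists r. Qed.

(** The infimum need not be attained, hence the additional 1. *)
Lemma hausdorff_dist_near A B r : (hausdorff_dist A B <= r%:E)%E ->
  (forall x, A x -> exists2 y, B y & mdist x y <= r + 1) /\
  (forall y, B y -> exists2 x, A x & mdist y x <= r + 1).
Proof.
move=> AB; have : (hausdorff_dist A B < (r + 1)%:E)%E.
  by apply: le_lt_trans AB _; rewrite lte_fin ltrDl.
move=> /ereal_inf_lt[_ [s [s0 sAB sBA] <-]]; rewrite lte_fin => /ltW sr.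
split=> x.
  by move=> /sAB[y By xy]; exists y => //; exact: le_trans sr.
by move=> /sBA[y By xy]; exists y => //; exact: le_trans sr.
Qed.

End Hausdorff.

Section Discretization.
Context {R : realType} {G : groupType} (S : generating_set G).
Local Notation cay := (cayley R S).
Local Notation qg := (qg S).
Local Notation wd := (wd S).
Implicit Types (lambda c : R) (k N : nat) (q : nat -> G) (eta : R -> cay).

Lemma mdistE (p q : cay) : mdist p q = cay_dist p q.
Proof. by []. Qed.

Lemma quasigeodesicP lambda c (I : set R) eta : quasigeodesic lambda c I eta <->
  is_interval I /\ forall s t, I s -> I t -> s <= t ->
    lambda^-1 * cay_dist (eta s) (eta t) - c <= t - s
    <= lambda * cay_dist (eta s) (eta t) + c.
Proof.
have mE (s t : R) : mdist (s : R^o) t = `|t - s| by [].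
split=> [[iI H]|[iI H]]; split => // s t Is It.
  move=> st; have := H s t Is It; rewrite mE mdistE.
  by rewrite ger0_norm ?subr_ge0.
rewrite mE mdistE; have [st|/ltW ts] := leP s t.
  by rewrite ger0_norm ?subr_ge0//; exact: H.
by rewrite distrC cay_dist_sym ger0_norm ?subr_ge0//; exact: H.
Qed.

Lemma geodesic_quasigeodesic (I : set R) eta : geodesic I eta -> quasigeodesic 1 0 I eta.
Proof.
move=> [iI H]; apply/quasigeodesicP; split => // s t Is It st.
rewrite -mdistE H// distrC ger0_norm ?subr_ge0//.
by rewrite invr1 !mul1r subr0 addr0 lexx.
Qed.

Lemma quasigeodesic_sub lambda c (a b a' b' : R) eta : a <= a' -> b' <= b ->
  quasigeodesic lambda c `[a, b] eta -> quasigeodesic lambda c `[a', b'] eta.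
Proof.
move=> aa bb /quasigeodesicP[_ H]; apply/quasigeodesicP.
split; first exact: interval_is_interval.
move=> s t; rewrite /= !in_itv /= => /andP[s1 s2] /andP[t1 t2] st.
by apply: H => //; rewrite /= in_itv /=; lra.
Qed.

(* The definition of a quasigeodesic does not require continuity. *)
Definition step_path q : R -> cay := fun t => vertex S (q (Num.truncn t)).

Lemma step_path_nat q i : step_path q i%:R = vertex S (q i).
Proof. by rewrite /step_path natrK. Qed.

(** Truncation changes a difference of times by less than 1, which the additive constant k + 2
    allows for. *)
Lemma step_path_quasigeodesic k q (t1 t2 : R) : (0 < k)%N -> 0 <= t1 -> t1 <= t2 ->
  qg k (Num.truncn t2 - Num.truncn t1) (fun i => q (Num.truncn t1 + i)%N) ->
  quasigeodesic k%:R (k + 2)%:R `[t1, t2] (step_path q).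
Proof.
move=> k0 t10 t12 Q; apply/quasigeodesicP; split; first exact: interval_is_interval.
move=> s t; rewrite /= !in_itv /= => /andP[s1 s2] /andP[tt1 tt2] st.
have s0 := le_trans t10 s1; have t0 := le_trans s0 st.
rewrite /step_path cay_dist_vertex.
have si := truncn_itv s0; have tj := truncn_itv t0.
have a1 := le_truncn s1; have a2 := le_truncn st; have a3 := le_truncn tt2.
set i := Num.truncn s in si a1 a2 *; set j := Num.truncn t in tj a2 a3 *.
have [h1 h2] := Q (i - Num.truncn t1)%N (j - Num.truncn t1)%N ltac:(lia).
have e : (j - Num.truncn t1 - (i - Num.truncn t1) = j - i)%N by lia.
rewrite e subnKC// subnKC// in h1 h2; last exact: leq_trans a2.
move: h1 h2; set d := wd _ _; rewrite -!(ler_nat R) !natrD !natrM natrB//.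
rewrite -!natr1 in si tj; set D : R := d%:R; set K : R := k%:R.
have K1 : 1 <= K by rewrite /K -[1]/(1%:R) ler_nat.
have D0 : 0 <= D by rewrite ler0n.
move=> h1 h2; apply/andP; split; last by lra.
have : K^-1 * D <= t - s + 2.
  rewrite ler_pdivrMl; last by lra.
  by apply: le_trans h1 _; rewrite -[X in _ + X]mulr1 -mulrDr ler_pM2l; lra.
lra.
Qed.

(** Constants for sampling at unit steps. Rounding two samples changes their distance by at most 2,
    and the last step may be shorter than 1; [disc_const] covers both. In [disc_gap], lambda (1 + c)
    bounds the distance to the preceding sample and 1 the rounding. *)
Definition disc_const lambda c : nat := (Num.truncn (lambda * (3 + c) + c + 3)).+1.
Definition disc_gap lambda c : R := lambda * (1 + c) + 1.

Lemma disc_const_mono lambda lambda' c c' : 1 <= lambda -> 0 <= c ->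
  lambda <= lambda' -> c <= c' -> (disc_const lambda c <= disc_const lambda' c')%N.
Proof.
move=> l1 c0 ll cc; rewrite ltnS; apply: le_truncn.
have : lambda * (3 + c) <= lambda' * (3 + c') by apply: ler_pM; lra.
lra.
Qed.

Lemma disc_gap_mono lambda lambda' c c' : 1 <= lambda -> 0 <= c ->
  lambda <= lambda' -> c <= c' -> disc_gap lambda c <= disc_gap lambda' c'.
Proof. by move=> l1 c0 ll cc; rewrite lerD2r; apply: ler_pM; lra. Qed.

Lemma disc_gap_ge0 lambda c : 1 <= lambda -> 0 <= c -> 0 <= disc_gap lambda c.
Proof. by move=> l1 c0; rewrite /disc_gap; nra. Qed.

Lemma discretize lambda c (a b : R) eta : 1 <= lambda -> 0 <= c -> a <= b ->
  quasigeodesic lambda c `[a, b] eta -> exists N q,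
  [/\ qg (disc_const lambda c) N q,
      q 0%N = round_vertex (eta a) /\ q N = round_vertex (eta b),
      forall t, a <= t <= b -> exists2 i, (i <= N)%N &
        cay_dist (eta t) (vertex S (q i)) <= disc_gap lambda c &
      forall i, (i <= N)%N -> exists2 t, a <= t <= b &
        cay_dist (vertex S (q i)) (eta t) <= 1].
Proof.
move=> l1 c0 ab /quasigeodesicP[_ Q].
(* The sample times are a + i, cut off at b, so that both ends are sampled. *)
pose N := (Num.truncn (b - a)).+1; pose T (i : nat) : R := Num.min (a + i%:R) b.
have ba0 : 0 <= b - a by rewrite subr_ge0.
have bN := truncn_itv ba0.
have Tab i : a <= T i <= b.
  by rewrite /T le_min ab ge_min lexx orbT lerDl ler0n.
have T0 : T 0%N = a by rewrite /T addr0 min_l.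
have TN : T N = b by rewrite /T min_r// -lerBlDl /N ltW//; case/andP: bN.
have Tlt i : (i < N)%N -> T i = a + i%:R.
  rewrite /N ltnS => iN; rewrite /T min_l// -lerBrDl.
  by case/andP: bN => + _; apply: le_trans; rewrite ler_nat.
exists N, (fun i => round_vertex (eta (T i))); split.
- move=> i j /andP[ij jN].
  have [->|nij] := eqVneq i j; first by rewrite wdxx subnn; split.
  have {nij}ij' : (i < j)%N by rewrite ltn_neqAle nij.
  have Ti := Tlt i (leq_trans ij' jN).
  have [Tj1 Tj2] : T j <= a + j%:R /\ a + j%:R <= T j + 1.
    split; first by rewrite /T ge_min lexx.
    have [jN'|Nj] := ltnP j N; first by rewrite Tlt//; lra.
    have -> : j = N by lia.
    by rewrite TN /N -natr1; case/andP: bN; lra.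
  have iT := ler_nat R i j; rewrite ij in iT.
  have Tij : T i <= T j.
    by rewrite Ti /T le_min lerD2l iT -Ti; case/andP: (Tab i).
  have := Q (T i) (T j); rewrite /= !in_itv /= !Tab => /(_ isT isT Tij).
  set D := cay_dist _ _ => /andP[h1 h2].
  have D0 : 0 <= D by apply: cay_dist_ge => l /polyline_ge0.
  set x := round_vertex _; set y := round_vertex _.
  have dx := round_vertex_dist (eta (T i)); have dy := round_vertex_dist (eta (T j)).
  rewrite -/x -/y in dx dy.
  have wxy := cay_dist_vertex (R := R) S x y.
  have t1 := cay_dist_triangle (eta (T i)) (vertex S x) (vertex S y).
  have t2 := cay_dist_triangle (eta (T j)) (eta (T i)) (vertex S y).
  have t3 := cay_dist_triangle (vertex S x) (eta (T i)) (eta (T j)).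
  have t4 := cay_dist_triangle (vertex S y) (vertex S x) (eta (T j)).
  rewrite (cay_dist_sym (vertex S x) (eta (T i))) in t1.
  rewrite (cay_dist_sym (vertex S y) (eta (T j))) in t4.
  rewrite -/D in t2 t3; rewrite wxy in t1 t4.
  set d := wd x y in t1 t4 *; set W : R := d%:R in t1 t4.
  have W0 : 0 <= W by rewrite ler0n.
  have hD : D <= lambda * (T j - T i + c).
    by rewrite -ler_pdivrMl; [lra|lra].
  set K := disc_const lambda c.
  have Kge : lambda * (3 + c) + c + 3 <= K%:R by rewrite ltW// /K /disc_const truncnS_gt.
  have ji : (j - i)%:R = j%:R - i%:R :> R by rewrite natrB.
  have ji0 : 0 <= j%:R - i%:R :> R by rewrite subr_ge0.
  have lc0 : 0 <= lambda * c by rewrite mulr_ge0; lra.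
  have Kl : lambda <= K%:R by lra.
  split; rewrite -(ler_nat R) natrD natrM ?ji -/W.
    have e1 : D <= lambda * (j%:R - i%:R + c) by apply: le_trans hD _; rewrite ler_pM2l; lra.
    have e2 : lambda * (j%:R - i%:R) <= K%:R * (j%:R - i%:R) by rewrite ler_wpM2r.
    lra.
  have e1 : lambda * D <= lambda * (W + 2) by rewrite ler_pM2l; lra.
  have e2 : lambda * W <= K%:R * W by rewrite ler_wpM2r.
  lra.
- by rewrite T0 TN.
- move=> t tab; have ta0 : 0 <= t - a by rewrite subr_ge0; case/andP: tab.
  have ti := truncn_itv ta0; set i := Num.truncn _ in ti.
  have iN : (i < N)%N by rewrite ltnS; apply: le_truncn; rewrite lerD2r; case/andP: tab.
  exists i; first exact: ltnW.
  apply: le_trans (cay_dist_triangle (eta (T i)) _ _) _.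
  rewrite lerD ?round_vertex_dist// cay_dist_sym.
  rewrite -natr1 in ti.
  have Tit : T i <= t by rewrite Tlt//; lra.
  have := Q (T i) t; rewrite /= !in_itv /= Tab => /(_ isT tab Tit) /andP[h1 _].
  have : lambda^-1 * cay_dist (eta (T i)) (eta t) <= 1 + c by rewrite Tlt// in h1 *; lra.
  by rewrite ler_pdivrMl//; lra.
- move=> i iN; exists (T i); first exact: Tab.
  by rewrite cay_dist_sym; exact: round_vertex_dist.
Qed.

End Discretization.

(** * Discrete and geometric stability *)

Section Generators.
Context {G : groupType} (S S' : generating_set G).

Lemma wlen_generators : exists C, forall x, (wlen S' x <= C * wlen S x)%N.
Proof.
have fl : finite_set (letter S).
  by apply: sub_finite_set (finite_ball S 1) => x; exact: wlen_letter.
have [C HC] := finite_nat_bound (wlen S') fl; exists C => x.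
have [s [ss ls sx]] := wlen_word S x; rewrite -ss -sx.
elim: s ls {ss sx} => [|y s IH] ls; first by rewrite big_nil wlen1.
rewrite big_cons /= mulnS; apply: leq_trans (wlenM _ _ _) _; apply: leq_add.
  by apply: HC; apply: ls; rewrite inE eqxx.
by apply: IH => z zs; apply: ls; rewrite inE zs orbT.
Qed.

End Generators.

Lemma dstable_generators {G : groupType} (S S' : generating_set G) (H : set G) :
  dstable S H -> dstable S' H.
Proof.
have [C HC] := wlen_generators S S'; have [C' HC'] := wlen_generators S' S.
move=> dH k; pose k' := (k * (C + C' + 1))%N.
have [D HD] := dH k'; exists (C * D)%N.
have wdC1 x y : (wd S' x y <= C * wd S x y)%N by exact: HC.
have wdC2 x y : (wd S x y <= C' * wd S' x y)%N by exact: HC'.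
have Qk N q : qg S' k N q -> qg S k' N q.
  move=> Q i j ij; have [h1 h2] := Q i j ij.
  have a1 := wdC1 (q i) (q j); have a2 := wdC2 (q i) (q j).
  split; first by apply: leq_trans a2 _; apply: leq_trans (_ : C' * (k * (j - i) + k) <= _)%N;
    [rewrite leq_mul2l h1 orbT|rewrite /k'; nia].
  apply: leq_trans h2 _; apply: leq_trans (_ : k * (C * wd S (q i) (q j)) + k <= _)%N;
    [by rewrite leq_add2r leq_mul2l a1 orbT|rewrite /k'; nia].
move=> N q Q q0 qN; have [nq fq] := HD N q (Qk _ _ Q) q0 qN.
have up x y : (wd S x y <= D)%N -> (wd S' x y <= C * D)%N.
  by move=> d; apply: leq_trans (wdC1 _ _) _; rewrite leq_mul2l d orbT.
split=> [i /nq[h Hh d]|N' q' Q' e0 eN i iN]; first by exists h => //; exact: up.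
by have [j jN d] := fq N' q' (Qk _ _ Q') e0 eN i iN; exists j => //; exact: up.
Qed.

Section Transfer.
Context {R : realType} {G : groupType} (S : generating_set G).
Local Notation cay := (cayley R S).
Local Notation qg := (qg S).
Local Notation wd := (wd S).
Local Notation step_path := (@step_path R G S).
Implicit Types (lambda c L mu : R) (k N : nat) (q : nat -> G) (eta gamma : R -> cay).
Implicit Types (H : set G) (M : R -> R -> R) (m : nat -> nat).

Definition nat_ceil (x : R) : nat := (Num.truncn x).+1.

Lemma nat_ceil_ge x : x <= (nat_ceil x)%:R.
Proof. by rewrite ltW// /nat_ceil truncnS_gt. Qed.

Lemma wd_nat_ceil x y r : cay_dist (vertex S x : cay) (vertex S y) <= r ->
  (wd x y <= nat_ceil r)%N.
Proof.
by rewrite cay_dist_vertex => xy; rewrite -(ler_nat R) (le_trans xy)// nat_ceil_ge.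
Qed.

(** The constant is k + 1, since [qg] admits k = 0 whereas the Morse condition is about constants
    lambda >= 1. *)
Lemma step_path_qg k N q : qg k N q ->
  quasigeodesic k.+1%:R (k.+1 + 2)%:R `[0, N%:R] (step_path q).
Proof.
move=> Q; apply: step_path_quasigeodesic => //.
rewrite truncn0 natrK subn0; apply: qg_mono Q; exact: leqnSn.
Qed.

Lemma morse_step M I gamma k N q (t1 t2 : R) : morse M I gamma -> qg k N q ->
  I t1 -> I t2 -> t1 <= t2 -> vertex S (q 0%N) = gamma t1 -> vertex S (q N) = gamma t2 ->
  let r := M k.+1%:R (k.+1 + 2)%:R + 1 in
  (forall i, (i <= N)%N -> exists2 t, t1 <= t <= t2 & cay_dist (vertex S (q i)) (gamma t) <= r) /\
  (forall t, t1 <= t <= t2 -> exists2 i, (i <= N)%N & cay_dist (gamma t) (vertex S (q i)) <= r).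
Proof.
move=> Mg Q It1 It2 t12 q0 qN r.
have k1 : 1 <= k.+1%:R :> R by rewrite -[1]/(1%:R) ler_nat.
have := Mg _ _ k1 (ler0n R (k.+1 + 2)%N) _ _ _ (ler0n R N) (step_path_qg Q) _ _ It1 It2 t12.
rewrite -[0]/(0%:R) !step_path_nat => /(_ q0 qN) /hausdorff_dist_near[h1 h2].
split.
  move=> i iN; have [|x [t tt <-]] := h2 (vertex S (q i)).
    exists i%:R; rewrite ?step_path_nat//= in_itv /= ler0n ler_nat iN //.
  by move=> d; exists t => //; move: tt; rewrite /= in_itv.
move=> t tt; have [|_ [s +] <-] := h1 (gamma t).
  by exists t => //=; rewrite in_itv.
rewrite /= in_itv /= => /andP[s0 sN] d; exists (Num.truncn s) => //.
by have := le_truncn sN; rewrite natrK.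
Qed.

(** Quasigeodesics with the same endpoints in H are compared through a real geodesic between these,
    which is Morse and near H. *)
Lemma stable_wrt_dstable M mu H : stable_wrt S M mu H -> dstable S H.
Proof.
move=> sH k; pose r := M k.+1%:R (k.+1 + 2)%:R + 1.
exists (nat_ceil (r + r) + nat_ceil (r + mu))%N => N q Q q0 qN.
have [gamma [gg g0 gn]] := @real_geodesic R G S (q 0%N) (q N).
set n : R := _%:R in gg gn.
have n0 : 0 <= n by rewrite ler0n.
have [Mg near] := sH _ _ _ n0 gg (ex_intro2 _ _ _ q0 g0) (ex_intro2 _ _ _ qN gn).
have I0 : `[0, n]%classic 0 by rewrite /= in_itv /= lexx.
have In : `[0, n]%classic n by rewrite /= in_itv /= lexx andbT.
have MQ N' q' : qg k N' q' -> q' 0%N = q 0%N -> q' N' = q N ->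
  (forall i, (i <= N')%N -> exists2 t, 0 <= t <= n & cay_dist (vertex S (q' i)) (gamma t) <= r) /\
  (forall t, 0 <= t <= n -> exists2 i, (i <= N')%N & cay_dist (gamma t) (vertex S (q' i)) <= r).
  by move=> Q' e0 eN; apply: (morse_step Mg Q' I0 In n0); rewrite ?e0 ?eN.
split=> [i iN|N' q' Q' e0 eN i iN].
  have [t tn d] := (MQ N q Q erefl erefl).1 i iN.
  have [|_ [h Hh <-] d'] := near (gamma t); first by exists t => //=; rewrite in_itv.
  exists h => //; apply: leq_trans (leq_addl _ _); apply: wd_nat_ceil.
  by rewrite (le_trans (cay_dist_triangle (gamma t) _ _))// lerD.
have [t tn d] := (MQ N q Q erefl erefl).1 i iN.
have [j jN d'] := (MQ N' q' Q' e0 eN).2 t tn.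
exists j => //; apply: leq_trans (leq_addr _ _); apply: wd_nat_ceil.
by rewrite (le_trans (cay_dist_triangle (gamma t) _ _))// lerD.
Qed.

(** Makes a gauge non-decreasing, as [morse_gauge] requires. *)
Definition sup_upto m k : nat := \max_(i < k.+1) m i.

Lemma sup_upto_ge m k : (m k <= sup_upto m k)%N.
Proof. by rewrite /sup_upto (bigD1 ord_max)//= leq_maxl. Qed.

Lemma sup_upto_mono m k k' : (k <= k')%N -> (sup_upto m k <= sup_upto m k')%N.
Proof.
move=> kk; apply/bigmax_leqP => i _.
have ik' : (i < k'.+1)%N by exact: leq_trans (ltn_ord i) _.
by rewrite /sup_upto (bigD1 (Ordinal ik'))//= leq_maxl.
Qed.

(** The discrete gauge at the constant of the sampled competitor, plus the sampling error [disc_gap]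
    of the competitor and an error C for the path itself. *)
Definition disc_gauge m (C : R) lambda c : R :=
  (sup_upto m (disc_const lambda c))%:R + disc_gap lambda c + C.

Lemma disc_gauge_morse m C : 0 <= C -> morse_gauge (disc_gauge m C).
Proof.
move=> C0; split=> [lambda c l1 c0|lambda lambda' c c' l1 c0 ll cc].
  by apply: addr_ge0 => //; apply: addr_ge0; [exact: ler0n|exact: disc_gap_ge0].
rewrite lerD2r; apply: lerD; last exact: disc_gap_mono.
by rewrite ler_nat; apply: sup_upto_mono; exact: disc_const_mono.
Qed.

(** Discretizing the whole geodesic shows that its points are near H. Subsegments, whose ends need
    not be in H, are then compared with discretized competitors by [dstable_hausdorff_close]. *)
Lemma dstable_stable_wrt H : dstable S H -> exists M mu,
  [/\ morse_gauge M, 0 <= mu & stable_wrt S M mu H].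
Proof.
move=> dH; pose C := disc_gap (1 : R) 0; pose K := disc_const (1 : R) 0.
have C0 : 0 <= C by rewrite disc_gap_ge0.
have [D0 HD0] := dH K; pose D := (nat_ceil (1 + C) + D0)%N.
have [m Hm] := choice_nat (fun k => dstable_hausdorff_close k D dH).
exists (disc_gauge m (1 + C)), (C + D0%:R); split.
- by apply: disc_gauge_morse; rewrite addr_ge0.
- by rewrite addr_ge0.
move=> a b gamma ab gg [h Hh ga] [h' Hh' gb].
have Qg := geodesic_quasigeodesic gg.
have [N [q [Qq [q0 qN] gq qg']]] := discretize (lexx 1) (lexx 0) ab Qg.
rewrite ga round_vertexK in q0; rewrite gb round_vertexK in qN.
have [nq _] := HD0 _ _ Qq ltac:(by rewrite q0) ltac:(by rewrite qN).
split; last first.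
  move=> _ [t /= + <-]; rewrite in_itv /= => tab.
  have [i iN d] := gq t tab; have [x Hx d'] := nq i iN.
  exists (vertex S x); first by exists x.
  rewrite mdistE (le_trans (cay_dist_triangle (vertex S (q i)) _ _))// lerD//.
  by rewrite cay_dist_vertex ler_nat.
move=> lambda c l1 c0 a' b' eta ab' Qe t1 t2; rewrite /= !in_itv /= => t1ab t2ab t12 e1 e2.
have [N1 [q1 [Qq1 [q10 q1N] gq1 qg1]]] := discretize l1 c0 ab' Qe.
have Qg' : quasigeodesic 1 0 `[t1, t2] gamma.
  by apply: quasigeodesic_sub Qg; lra.
have [N2 [q2 [Qq2 [q20 q2N] gq2 qg2]]] := discretize (lexx 1) (lexx 0) t12 Qg'.
have nr t : a <= t <= b -> near_set S (lcoset_of 1%g H) D (round_vertex (gamma t)).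
  move=> tab; apply/near_set_mulV; rewrite invg1 mul1g.
  have [i iN d] := gq t tab; apply: near_set_trans (nq i iN).
  apply: wd_nat_ceil; rewrite (le_trans (cay_dist_triangle (gamma t) _ _))// lerD//.
  by rewrite cay_dist_sym round_vertex_dist.
set k := disc_const lambda c in Qq1.
have Qq2' : qg k N2 q2 by apply: qg_mono Qq2; apply: disc_const_mono.
have [F F'] : hausdorff_close S (m k) N2 q2 N1 q1.
  apply: (Hm k 1%g) => //.
  - by rewrite q20; exact: nr.
  - by rewrite q2N; exact: nr.
  - by rewrite q20 q10 e1 wdxx.
  - by rewrite q2N q1N e2 wdxx.
have mk : (m k)%:R <= (sup_upto m k)%:R :> R by rewrite ler_nat sup_upto_ge.
have gap0 : 0 <= disc_gap lambda c by exact: disc_gap_ge0.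
apply: hausdorff_dist_le; first by rewrite /disc_gauge -/k; move: (ler0n R (sup_upto m k)); lra.
- move=> _ [t /= + <-]; rewrite in_itv /= => tt.
  have [i iN d] := gq2 t tt; have [j jN d'] := F i iN; have [s sab d''] := qg1 j jN.
  exists (eta s); first by exists s => //=; rewrite in_itv.
  rewrite mdistE /disc_gauge -/k.
  have := cay_dist_triangle (vertex S (q2 i)) (gamma t) (eta s).
  have := cay_dist_triangle (vertex S (q1 j)) (vertex S (q2 i)) (eta s).
  have : cay_dist (vertex S (q2 i) : cay) (vertex S (q1 j)) <= (m k)%:R.
    by rewrite cay_dist_vertex ler_nat.
  rewrite -/C in d; lra.
- move=> _ [t /= + <-]; rewrite in_itv /= => tt.
  have [i iN d] := gq1 t tt; have [j jN d'] := F' i iN; have [s sab d''] := qg2 j jN.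
  exists (gamma s); first by exists s => //=; rewrite in_itv.
  rewrite mdistE /disc_gauge -/k.
  have := cay_dist_triangle (vertex S (q1 i)) (eta t) (gamma s).
  have := cay_dist_triangle (vertex S (q2 j)) (vertex S (q1 i)) (gamma s).
  have : cay_dist (vertex S (q1 i) : cay) (vertex S (q2 j)) <= (m k)%:R.
    by rewrite cay_dist_vertex ler_nat.
  lra.
Qed.

(** The discrete local condition makes [step_path] a local Morse quasigeodesic, after discretizing
    the competitors. The global conclusion is then read off at integer times. *)
Lemma mltg_dmltg : morse_local_to_global cay -> dmltg S.
Proof.
move=> mltg k m; pose M := disc_gauge m 1.
have k1 (l : nat) : 1 <= l.+1%:R :> R by rewrite -[1]/(1%:R) ler_nat.
have [L [M' [l' [c' [L0 gM' l1 c0 HL]]]]] := mltg M k.+1%:R (k.+1 + 2)%:R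
  (disc_gauge_morse m ler01) (k1 k) (ler0n _ _).
exists (nat_ceil L), (nat_ceil (l' * (1 + c') + c')),
  (fun l => nat_ceil (M' l.+1%:R (l.+1 + 2)%:R + 1)).
move=> N v Hv; have v0N : is_interval (`[0, N%:R]%classic : set R) by exact: interval_is_interval.
have [] : morse_quasigeodesic M' l' c' `[0, N%:R] (step_path v).
  apply: HL; split => // t1 t2; rewrite /= !in_itv /= => /andP[t10 t1N] /andP[t20 t2N] t12 tL.
  have i12 := le_truncn t12; have i2N := le_truncn t2N; rewrite natrK in i2N.
  have i1t := truncn_itv t10; have i2t := truncn_itv t20.
  set i1 := Num.truncn t1 in i12 i1t *; set i2 := Num.truncn t2 in i12 i2N i2t *.
  have [||Qv Mv] := Hv i1 i2; first by rewrite i12.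
    rewrite /nat_ceil -ltnS -(ltr_nat R) natrB//.
    have := truncnS_gt L; rewrite -!natr1 in i1t i2t *; lra.
  split.
    apply: step_path_quasigeodesic => //; exact: qg_mono (leqnSn k) Qv.
  move=> lambda c l1' c0' a b eta ab Qe s1 s2.
  rewrite /= !in_itv /= => /andP[s11 s12'] /andP[s21 s22] s12 e1 e2.
  have [N1 [q1 [Qq1 [q10 q1N] gq1 qg1]]] := discretize l1' c0' ab Qe.
  rewrite e1 round_vertexK in q10; rewrite e2 round_vertexK in q1N.
  have ij1 := le_truncn s11; have j12 := le_truncn s12; have j2i := le_truncn s22.
  rewrite -/i1 in ij1; rewrite -/i2 in j2i.
  set j1 := Num.truncn s1 in ij1 j12 q10 *; set j2 := Num.truncn s2 in j12 j2i q1N *.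
  set K := disc_const lambda c in Qq1.
  have jj : (j1 - i1 <= j2 - i1 <= i2 - i1)%N by rewrite !leq_sub2r.
  have [||F F'] := Mv K (j1 - i1)%N (j2 - i1)%N N1 q1 jj Qq1.
  - by rewrite subnKC.
  - by rewrite subnKC// (leq_trans ij1).
  have nj : (j2 - i1 - (j1 - i1) = j2 - j1)%N by rewrite subnBA// subnK// (leq_trans ij1).
  rewrite nj in F F'.
  have mk : (m K)%:R <= (sup_upto m K)%:R :> R by rewrite ler_nat sup_upto_ge.
  have gap0 : 0 <= disc_gap lambda c by exact: disc_gap_ge0.
  apply: hausdorff_dist_le.
  - by rewrite /M /disc_gauge -/K; move: (ler0n R (sup_upto m K)); lra.
  - move=> _ [t /= + <-]; rewrite in_itv /= => /andP[s1t ts2].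
    have j1t := le_truncn s1t; have tj2 := le_truncn ts2.
    rewrite -/j1 in j1t; rewrite -/j2 in tj2.
    have [|j jN d] := F (Num.truncn t - j1)%N; first exact: leq_sub2r.
    have [s sab d'] := qg1 j jN.
    exists (eta s); first by exists s => //=; rewrite in_itv.
    rewrite mdistE /step_path /M /disc_gauge -/K.
    have e : (i1 + (j1 - i1 + (Num.truncn t - j1)))%N = Num.truncn t.
      by rewrite addnA (subnKC ij1) subnKC.
    rewrite e in d.
    have := cay_dist_triangle (vertex S (q1 j)) (vertex S (v (Num.truncn t))) (eta s).
    have : cay_dist (vertex S (v (Num.truncn t)) : cay) (vertex S (q1 j)) <= (m K)%:R.
      by rewrite cay_dist_vertex ler_nat.
    lra.
  - move=> _ [t /= + <-]; rewrite in_itv /= => tab.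
    have [i iN d] := gq1 t tab; have [j jN d'] := F' i iN.
    pose l := (j1 + j)%N; have lj2 : (j1 <= l <= j2)%N by rewrite /l leq_addr -leq_subRL.
    have e : (i1 + (j1 - i1 + j))%N = l by rewrite addnA (subnKC ij1).
    rewrite e in d'.
    have close_l : cay_dist (eta t) (vertex S (v l)) <= M lambda c.
      rewrite /M /disc_gauge -/K.
      have := cay_dist_triangle (vertex S (q1 i)) (eta t) (vertex S (v l)).
      have : cay_dist (vertex S (q1 i) : cay) (vertex S (v l)) <= (m K)%:R.
        by rewrite cay_dist_vertex ler_nat.
      lra.
    have s10 : 0 <= s1 by exact: le_trans s11.
    (* If l = j1, the time l may precede s1 and so lie outside [s1, s2]; but [step_path] takes the
       same value at s1. *)
    have [lj1|nlj1] := eqVneq l j1.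
      exists (step_path v s1); first by exists s1 => //=; rewrite in_itv /= lexx.
      by rewrite mdistE /step_path -/j1 -lj1; exact: close_l.
    exists (step_path v l%:R); last by rewrite step_path_nat mdistE; exact: close_l.
    exists l%:R => //=; rewrite in_itv /=; apply/andP; split.
      apply: (@le_trans _ _ j1.+1%:R); first by rewrite ltW// truncnS_gt.
      by rewrite ler_nat ltn_neqAle eq_sym nlj1; case/andP: lj2.
    have s20 : 0 <= s2 by exact: le_trans s12.
    apply: (@le_trans _ _ j2%:R); first by rewrite ler_nat; case/andP: lj2.
    by case/andP: (truncn_itv s20).
move=> /quasigeodesicP[_ Q] Mq.
have I0N (i : nat) : (i <= N)%N -> `[0, N%:R]%classic (i%:R : R).
  by move=> iN; rewrite /= in_itv /= ler0n ler_nat.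
split.
  move=> i j /andP[ij jN].
  have := Q i%:R j%:R (I0N _ (leq_trans ij jN)) (I0N _ jN).
  rewrite ler_nat ij !step_path_nat cay_dist_vertex => /(_ isT) /andP[h1 h2].
  set K := nat_ceil _; have Kge : l' * (1 + c') + c' <= K%:R by exact: nat_ceil_ge.
  have d0 := ler0n R (wd (v i) (v j)); set d : R := _%:R in h1 h2 d0.
  have ji0 : 0 <= j%:R - i%:R :> R by rewrite subr_ge0 ler_nat.
  have lc0 : 0 <= l' * c' by rewrite mulr_ge0; lra.
  have lK : l' <= K%:R by lra.
  split; rewrite -(ler_nat R) natrD natrM natrB// -/d.
    have e1 : d <= l' * (j%:R - i%:R + c') by rewrite -ler_pdivrMl; lra.
    have e2 : l' * (j%:R - i%:R) <= K%:R * (j%:R - i%:R) by rewrite ler_wpM2r.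
    lra.
  have e2 : l' * d <= K%:R * d by rewrite ler_wpM2r.
  lra.
move=> l a b N' q /andP[ab bN] Qq q0 qN.
have ab' : a%:R <= b%:R :> R by rewrite ler_nat.
have [||h1 h2] := morse_step Mq Qq (I0N _ (leq_trans ab bN)) (I0N _ bN) ab'.
- by rewrite step_path_nat q0.
- by rewrite step_path_nat qN.
split.
  move=> i iab; have [|j jN d] := h2 (a + i)%:R.
    by rewrite !ler_nat leq_addr/=; lia.
  by exists j => //; apply: wd_nat_ceil; rewrite step_path_nat in d.
move=> j jN; have [t /andP[at_ tb] d] := h1 j jN.
have a1 := le_truncn at_; have a2 := le_truncn tb; rewrite !natrK in a1 a2.
exists (Num.truncn t - a)%N; first lia.
by apply: wd_nat_ceil; rewrite subnKC.
Qed.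

End Transfer.

(** * Setwise products of stable subgroups as products over lists *)

Lemma sprod_map {G : groupType} (I : eqType) (H : I -> set G) (s : seq I) (x : G) :
  uniq s -> sprod [seq H i | i <- s] x <->
  exists2 h : I -> G, (forall i, i \in s -> H i (h i)) & (\prod_(i <- s) h i)%g = x.
Proof.
elim: s x => [|i s IH] x /=.
  by move=> _; split=> [->|[h _ <-]]; [exists (fun=> 1%g)|]; rewrite ?big_nil.
move=> /andP[iNs us]; split.
  move=> [y Hy [_ /(IH _ us)[h Hh <-] <-]].
  have hE j : j \in s -> (if j == i then y else h j) = h j.
    by move=> js; case: eqP => // ji; rewrite -ji js in iNs.
  exists (fun j => if j == i then y else h j).
    by move=> j; rewrite inE; case: eqP => [->//|_] /=; exact: Hh.
  by rewrite big_cons eqxx; congr (_ * _)%g; exact: eq_big_seq.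
move=> [h Hh <-]; rewrite big_cons; exists (h i); first by apply: Hh; rewrite inE eqxx.
exists (\prod_(j <- s) h j)%g => //; apply/(IH _ us); exists h => // j js.
by apply: Hh; rewrite inE js orbT.
Qed.

Theorem theorem1p1 (R : realType) (G : groupType)
    (G_fg : finitely_generated G) (G_mltg : MLTG_group R G)
    (G_sep : forall H : set G, stable_subgroup R H -> separable H)
    (n : nat) (n_ge1 : (1 <= n)%N) (H : 'I_n -> set G)
    (H_stable : forall i, stable_subgroup R (H i)) :
  separable (setwise_prod H).
Proof.
have [S mltg] := G_mltg.
have sep K : dstable_subgroup S K -> separable K.
  move=> [sK dK]; apply: G_sep; split => //; exists S.
  exact: dstable_stable_wrt dK.
apply: (coset_products_separable (mltg_dmltg mltg) sep (n := n)).
exists [seq H i | i <- index_enum 'I_n], 1%g; split.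
- rewrite size_map -[leqRHS](size_enum_ord n); apply: uniq_leq_size => [|i _].
    exact: index_enum_uniq.
  by rewrite mem_enum.
(* Each factor is stable for a generating set of its own; discrete stability passes to the set S of
   the local-to-global hypothesis. *)
- move=> _ /mapP[i _ ->]; have [sH [S' [M [mu [_ _ /stable_wrt_dstable dH]]]]] := H_stable i.
  by split => //; exact: dstable_generators dH.
apply/seteqP; split=> x.
  move=> [h Hh <-]; apply/rtransE; rewrite invg1 mulg1.
  by apply/sprod_map; [exact: index_enum_uniq|exists h].
move=> /rtransE; rewrite invg1 mulg1 => /sprod_map[|h Hh <-]; first exact: index_enum_uniq.
by exists h => // i; apply: Hh; rewrite mem_index_enum.
Qed.
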